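(* Consider the homogeneous single-source $n$-server status-update network (described in the context) with $n\ge 1$, per-server arrival rate $\lambda>0$ and per-server service rate $\mu>0$, and let $\rho=\lambda/\mu$. Then the average age of information at the monitor is $$\Delta=\frac{1}{\mu}\left[\frac{1}{n\rho}\sum_{j=1}^{n-1}\prod_{i=1}^{j}\frac{\rho(n-i+1)}{i+(n-i)\rho}+\frac{1}{n\rho}+\frac{1}{n^2}\prod_{i=1}^{n-1}\frac{\rho(n-i+1)}{i+(n-i)\rho}\right],$$ where an empty sum is $0$ and an empty product is $1$.
   Context: Network model: there are $m$ independent information sources, $n$ servers and one monitor. Updates of source $i$ arrive at server $j$ according to a Poisson process of rate $\lambda_j^{(i)}>0$; all arrival processes are mutually independent. An update's generation time is its arrival time at the server. Each server $j$ sends updates to the monitor over its own link; service times are i.i.d. exponential with rate $\mu_j>0$, independent of everything else. Each server uses last-come-first-serve with preemption in service (LCFS): when a new update (of any source) arrives at a server, the server immediately discards the update it is serving (if any) and starts serving the new one; when a service completes, the update is delivered to the monitor and the server becomes idle until the next arrival. For source $i$, let $u_i(t)$ be the largest generation time among updates of source $i$ delivered to the monitor by time $t$; the age of information is $\Delta_i(t)=t-u_i(t)$ and the average age of information is $\Delta_i=\lim_{T\to\infty}\frac1T\int_0^T\Delta_i(t)\,dt$ (equivalently $\lim_{t\to\infty}\mathbb E[\Delta_i(t)]$). The network is homogeneous if $\lambda_j^{(i)}=\lambda^{(i)}$ and $\mu_j=\mu$ for all $i,j$. In the single-source case ($m=1$) write $\lambda=\lambda^{(1)}$ and $\Delta=\Delta_1$.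 *)

(* Defs.v *)
From HB Require Import structures.
From mathcomp Require Import all_boot all_order all_algebra.
From mathcomp Require Import all_classical all_reals all_analysis.
Set Implicit Arguments. Unset Strict Implicit. Unset Printing Implicit Defensive.
Import Order.TTheory GRing.Theory Num.Theory.
Import numFieldNormedType.Exports.
Local Open Scope classical_set_scope.
Local Open Scope ring_scope.

Definition mutually_independent d (T : measurableType d) (R : realType)
  (P : probability T R) (I : eqType) (F : I -> T -> R) : Prop :=
  forall (s : seq I) (B : I -> set R), uniq s ->
    (forall i, measurable (B i)) ->
    P (\bigcap_(i in [set` s]) (F i @^-1` B i)) =
    (\prod_(i <- s) P (F i @^-1` B i))%E.

Definition exp_distributed d (T : measurableType d) (R : realType)
  (P : probability T R) (r : R) (X : {RV P >-> R}) : Prop :=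
  forall A : set R, measurable A -> distribution P X A = exponential_prob r A.

(* The whole family of primitive random variables: (false, j, k) is the
   k-th interarrival time at server j, (true, j, k) is the service time
   drawn by the k-th update arriving at server j. *)
Definition all_rvs (n : nat) (T : Type) (R : Type)
  (X S : 'I_n -> nat -> T -> R) (i : bool * 'I_n * nat) : T -> R :=
  if i.1.1 then S i.1.2 i.2 else X i.1.2 i.2.

(* Arrival (= generation) time of the k-th update (k = 0,1,...) at server j *)
Definition arrival (R : realType) (n : nat) (T : Type)
  (X : 'I_n -> nat -> T -> R) (j : 'I_n) (k : nat) (w : T) : R :=
  \sum_(i < k.+1) X j i w.

(* Under LCFS with preemption, the k-th update of server j is delivered iff
   its service finishes before the next arrival at that server; it is then
   delivered at time arrival + service time. *)
Definition delivered (R : realType) (n : nat) (T : Type)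
  (X S : 'I_n -> nat -> T -> R) (j : 'I_n) (k : nat) (w : T) : Prop :=
  S j k w < X j k.+1 w.

(* Largest generation time among updates delivered by time t
   (with the convention u(t) = 0 when nothing has been delivered yet). *)
Definition latest_gen (R : realType) (n : nat) (T : Type)
  (X S : 'I_n -> nat -> T -> R) (w : T) (t : R) : R :=
  sup ([set 0] `|` [set a | exists (j : 'I_n) (k : nat),
        [/\ delivered X S j k w, arrival X j k w + S j k w <= t
          & a = arrival X j k w]]).

Definition age (R : realType) (n : nat) (T : Type)
  (X S : 'I_n -> nat -> T -> R) (w : T) (t : R) : R :=
  t - latest_gen X S w t.

Definition avg_age_upto (R : realType) (n : nat) (T : Type)
  (X S : 'I_n -> nat -> T -> R) (w : T) (tau : R) : R :=
  tau^-1 * Rintegral lebesgue_measure `[0, tau] (age X S w).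

Definition prodP (R : realType) (n : nat) (rho : R) (j : nat) : R :=
  \prod_(1 <= i < j.+1) ((rho * (n - i + 1)%:R) / (i%:R + (n - i)%:R * rho)).

Definition age_formula (R : realType) (n : nat) (lam mu : R) : R :=
  let rho := lam / mu in
  mu^-1 * ((n%:R * rho)^-1 * (\sum_(1 <= j < n) prodP n rho j)
           + (n%:R * rho)^-1
           + (n%:R ^+ 2)^-1 * prodP n rho n.-1).

(* Main.v *)
(** Fix a mesh [dt].  The servers are independent, and the age at time [t]
    exceeds [y] iff at every server no update generated after [t - y] is
    delivered by [t].  Restarting a server at its first arrival after [t - y]
    (memorylessness), the time to its next delivery from [t - y] on is a sum of
    two independent exponential times of rates [lam] and [mu], and is independent
    of what happened before [t - y].  Hence the age exceeds [y] with probability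
    [g y ^ n], [g] being the tail of that sum, and the event that the age at
    [k dt] exceeds [l dt] is independent of the event that the age at [k' dt]
    exceeds [l' dt] as soon as [k < k' - l'].  The variance of the number of such
    events is therefore linear in the number of time steps, which gives almost sure
    convergence of the averages along the squares, and then everywhere because
    the integral of the age is monotone.  The limit is within [dt] of the integral
    of [g ^ n], computed by integrating the recursion
    [(c ^ k g ^ m)' = m lam c ^ (k + 1) g ^ (m - 1) - (k mu + m lam) c ^ k g ^ m]
    for [c = exp (- mu x)]. *)

Require Import Defs.
From HB Require Import structures.
From mathcomp Require Import all_boot all_order all_algebra.
From mathcomp Require Import all_classical all_reals all_analysis.
From mathcomp Require Import measurable_realfun ring lra zify.
Set Implicit Arguments. Unset Strict Implicit. Unset Printing Implicit Defensive.
Import Order.TTheory GRing.Theory Num.Theory.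
Import numFieldNormedType.Exports.
Local Open Scope classical_set_scope.
Local Open Scope ring_scope.

(** * Real-valued probabilities and independence *)

Section real_probability.
Context d (T : measurableType d) (R : realType) (P : probability T R).

(** Two features replace ergodic or renewal theory. The law is exact at every finite time: for
    [0 < s <= t] the probability of [stale s t] depends on [t - s] alone, so the empty start shows
    only through the restriction [l < k] on the lags. And two events are dependent only if their
    time windows meet, while their probabilities decay geometrically in the lag, so second moments
    suffice: a variance of order [K], divided by [K ^ 2], is summable along the squares, and
    consecutive squares have ratio tending to 1. The obstacle is that the first delivery may come
    after any number of preemptions. It is never treated as one random variable: for each [M] the
    description is cut after [M] preemptions, in such a way that its law does not depend on [M], and
    the paths on which the cut matters have vanishing probability. Independence is given as a
    product formula for finitely many variables. Conditioning is therefore done by splitting the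
    indices into disjoint blocks and slicing a product measure. *)

Definition pr (A : set T) : R := fine (P A).

Lemma prE A : measurable A -> P A = (pr A)%:E.
Proof. by move=> mA; rewrite /pr fineK// fin_num_measure. Qed.

Lemma pr_ge0 A : 0 <= pr A.
Proof. exact: fine_ge0. Qed.

Lemma le_pr A B : measurable A -> measurable B -> A `<=` B -> pr A <= pr B.
Proof.
by move=> mA mB AB; rewrite -lee_fin -!prE// le_measure// inE.
Qed.

Lemma pr_le1 A : measurable A -> pr A <= 1.
Proof. by move=> mA; rewrite -lee_fin -prE// probability_le1. Qed.

Lemma prT : pr setT = 1.
Proof. by rewrite /pr probability_setT. Qed.

Lemma prDI A B : measurable A -> measurable B ->
  pr (A `&` B) + pr (A `\` B) = pr A.
Proof.
move=> mA mB; apply: EFin_inj; rewrite EFinD -!prE//.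
- by rewrite addeC; apply/esym/measureDI.
- exact: measurableD.
- exact: measurableI.
Qed.

Lemma prI_inclusion_exclusion A B : measurable A -> measurable B ->
  pr (A `&` B) = pr A + pr B - pr (A `|` B).
Proof.
move=> mA mB; have := prDI mA mB.
have h : pr (A `|` B) = pr (A `\` B) + pr B.
  apply: EFin_inj; rewrite EFinD -!prE//; [|exact: measurableD|exact: measurableU].
  rewrite -measureU//; [|exact: measurableD|by rewrite setDE -setIA setICl setI0].
  by rewrite setDE setUIl (setUC (~` B)) setUv setIT.
by rewrite h; lra.
Qed.

Lemma eq_pr_on (O A B : set T) : measurable O -> measurable A -> measurable B ->
  P O = 1%E -> (forall w, O w -> A w <-> B w) -> pr A = pr B.
Proof.
move=> mO mA mB PO AB.
have h C : measurable C -> pr C = pr (C `&` O).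
  move=> mC; rewrite prI_inclusion_exclusion//.
  have -> : pr (C `|` O) = 1.
    apply/le_anti/andP; split; first by apply: pr_le1; exact: measurableU.
    have <- : pr O = 1 by rewrite /pr PO.
    by apply: le_pr => [||x]; [|exact: measurableU|right].
  by rewrite /pr PO /=; lra.
rewrite (h A)// (h B)//; congr pr.
by apply/seteqP; split => w [Aw Ow]; split => //; apply/(AB w Ow).
Qed.

(* The inequality holds because each of [A], [B] lies in the union of the other
   with the exceptional event. *)
Lemma pr_dist_le (O A B C : set T) : measurable O -> measurable A ->
  measurable B -> measurable C -> P O = 1%E ->
  (forall w, O w -> ~ C w -> A w <-> B w) -> `|pr A - pr B| <= pr C.
Proof.
move=> mO mA mB mC PO AB.
have h D E : measurable D -> measurable E ->
    (forall w, O w -> ~ C w -> D w -> E w) -> pr D - pr E <= pr C.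
  move=> mD mE DE.
  have mDO := measurableI _ _ mD mO.
  have <- : pr (D `&` O) = pr D.
    by apply: (eq_pr_on mO) => // w Ow; split => [[]|].
  have := prI_inclusion_exclusion mE mC; have := pr_ge0 (E `&` C).
  have : pr (D `&` O) <= pr (E `|` C).
    apply: le_pr => //; first exact: measurableU.
    by move=> w [Dw Ow]; have [Cw|nC] := pselect (C w); [right|left; apply: DE].
  by lra.
rewrite ler_norml; apply/andP; split.
  by rewrite lerNl opprB; apply: h => // w Ow nC; apply AB.
by apply: h => // w Ow nC; apply AB.
Qed.

End real_probability.

(** * Independence of the sigma-algebras of disjoint blocks of variables *)

Section independence.
Context d (T : measurableType d) (R : realType) (P : probability T R).
Context (I : choiceType) (F : I -> T -> R).
Hypothesis mF : forall i, measurable_fun setT (F i).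
Hypothesis indF : mutually_independent P F.

Definition gen_of (J : set I) : set (set T) :=
  [set A | exists i (B : set R), [/\ J i, measurable B & A = F i @^-1` B]].

Definition sigma_of (J : set I) : set (set T) := <<s gen_of J >>.

Lemma sigma_of_measurable J A : sigma_of J A -> measurable A.
Proof.
apply: smallest_sub; first exact: sigma_algebra_measurable.
by move=> _ [i [B [_ mB ->]]]; rewrite -[X in measurable X]setTI; exact: mF.
Qed.

Lemma sigma_of_sub J J' : J `<=` J' -> sigma_of J `<=` sigma_of J'.
Proof.
move=> JJ'; apply: sub_sigma_algebra2 => _ [i [B [Ji mB ->]]].
by exists i, B; split => //; exact: JJ'.
Qed.

(** Finite cylinders form a pi-system generating [sigma_of J]. The product formula of
    [mutually_independent] bears on them directly. *)
Definition cyl_of (J : set I) : set (set T) :=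
  [set A | exists (s : seq I) (B : I -> set R),
    [/\ {in s, forall i, J i}, forall i, measurable (B i) &
        A = \bigcap_(i in [set` s]) F i @^-1` B i]].

Lemma setI_closed_cyl J : setI_closed (cyl_of J).
Proof.
move=> _ _ [s1 [B1 [J1 m1 ->]]] [s2 [B2 [J2 m2 ->]]].
exists (s1 ++ s2), (fun i => (if i \in s1 then B1 i else setT) `&`
                             (if i \in s2 then B2 i else setT)); split.
- by move=> i; rewrite mem_cat => /orP[/J1|/J2].
- by move=> i; apply: measurableI; case: ifP.
- apply/seteqP; split => w.
    move=> [h1 h2] i /= _; split; case: ifPn => // ?; [exact: h1|exact: h2].
  move=> h; split => i /= si.
    have [|+ _] := h i; first by rewrite /= mem_cat si.
    by rewrite /= si.
  have [|_ +] := h i; first by rewrite /= mem_cat si orbT.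
  by rewrite /= si.
Qed.

Lemma cyl_of_measurable J A : cyl_of J A -> measurable A.
Proof.
move=> [s [B [_ mB ->]]]; apply: fin_bigcap_measurable => [|i _]; first exact: finite_seq.
by rewrite -[X in measurable X]setTI; exact: mF.
Qed.

Lemma sigma_of_cyl J : sigma_of J `<=` <<d cyl_of J>>.
Proof.
rewrite setI_closed_g_dynkin_g_sigma_algebra; last exact: setI_closed_cyl.
apply: sub_sigma_algebra2 => _ [i [B [Ji mB ->]]].
exists [:: i], (fun=> B); split => //; first by move=> k; rewrite inE => /eqP->.
apply/seteqP; split => w /=; first by move=> Bw k /=; rewrite inE => /eqP ->.
by apply; rewrite /= inE.
Qed.

Lemma indep_cyl J1 J2 A1 A2 : J1 `&` J2 = set0 -> cyl_of J1 A1 -> cyl_of J2 A2 ->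
  P (A1 `&` A2) = (P A1 * P A2)%E.
Proof.
move=> J12 [s1 [B1 [h1 m1 ->]]] [s2 [B2 [h2 m2 ->]]].
have un s (B : I -> set R) : \bigcap_(i in [set` s]) F i @^-1` B i =
    \bigcap_(i in [set` undup s]) F i @^-1` B i.
  by congr (bigcap _ _); apply/seteqP; split => i /=; rewrite mem_undup.
have ds i : i \in s1 -> i \in s2 -> False.
  by move=> /h1 a /h2 b; suff : (set0 : set I) i by []; rewrite -J12.
rewrite (un s1) (un s2).
pose B i := if i \in s1 then B1 i else B2 i.
rewrite !indF ?undup_uniq//.
have -> : \bigcap_(i in [set` undup s1]) F i @^-1` B1 i `&`
    \bigcap_(i in [set` undup s2]) F i @^-1` B2 i =
    \bigcap_(i in [set` undup s1 ++ undup s2]) F i @^-1` B i.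
  apply/seteqP; split => w.
    move=> [g1 g2] i /=; rewrite mem_cat /B.
    case: ifPn => [is1 _|ns1]; first by apply: g1; rewrite /= mem_undup.
    by rewrite mem_undup (negbTE ns1) /= => ?; exact: g2.
  move=> g; split => i /= si.
    have := g i; rewrite /= mem_cat si => /(_ isT); rewrite /B.
    by move: si; rewrite mem_undup => ->.
  have := g i; rewrite /= mem_cat si orbT => /(_ isT); rewrite /B.
  case: ifPn => // /ds; move: si; rewrite mem_undup => si /(_ si) [].
rewrite indF.
- rewrite big_cat /=; congr (_ * _)%E; rewrite big_seq [RHS]big_seq;
    apply: eq_bigr => i; rewrite mem_undup => si; rewrite /B ?si//.
  by case: ifPn => // /ds/(_ si).
- rewrite cat_uniq !undup_uniq /= andbT; apply/hasPn => i.
  by rewrite !mem_undup => s2i; apply/negP => /ds/(_ s2i).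
- by move=> i; rewrite /B; case: ifP.
Qed.

Lemma dynkin_indep B : measurable B ->
  dynkin [set A | measurable A /\ P (A `&` B) = (P A * P B)%E].
Proof.
move=> mB; split.
- by split => //=; rewrite setTI [X in (X * _)%E]probability_setT mul1e.
- move=> A [mA hA]; split; first exact: measurableC.
  rewrite !prE//; [|exact: measurableC|by apply: measurableI => //; exact: measurableC].
  rewrite -EFinM; congr (_%:E).
  have := prDI P mB mA; have := prDI P measurableT mA.
  move: hA; rewrite !prE//; last exact: measurableI.
  rewrite -EFinM => h; have {h} := EFin_inj h; rewrite setTI setTD prT setDE.
  rewrite (setIC B) (setIC B) => e1 e2 e3.
  have -> : pr P (~` A) = 1 - pr P A by lra.
  by rewrite mulrBl mul1r -e1; lra.
- move=> f tf hf; split; first by apply: bigcup_measurable => k _; exact: (hf k).1.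
  rewrite setI_bigcupl measure_bigcup//=; last 2 first.
  - by move=> k _; apply: measurableI => //; exact: (hf k).1.
  - by apply: trivIset_setIr.
  rewrite measure_bigcup//=; last by move=> k _; exact: (hf k).1.
  rewrite muleC (prE P mB) -nneseriesZl// -(prE P mB).
  by apply: eq_eseriesr => k _; rewrite muleC; exact: (hf k).2.
Qed.

(** The pi-lambda argument is run twice: with a cylinder of [J2] fixed, the first factor is extended
    from cylinders to [sigma_of J1]; then, with [A1] fixed, the second factor is extended. *)
Lemma indep_sigma J1 J2 A1 A2 : J1 `&` J2 = set0 ->
  sigma_of J1 A1 -> sigma_of J2 A2 -> pr P (A1 `&` A2) = pr P A1 * pr P A2.
Proof.
move=> J12 s1 s2.
have m1 := sigma_of_measurable s1; have m2 := sigma_of_measurable s2.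
apply: EFin_inj; rewrite EFinM -!prE//; last exact: measurableI.
suff H B : cyl_of J2 B ->
    <<d cyl_of J1>> `<=` [set A | measurable A /\ P (A `&` B) = (P A * P B)%E].
  have : <<d cyl_of J2>> `<=` [set A | measurable A /\ P (A `&` A1) = (P A * P A1)%E].
    apply: smallest_sub; first exact: dynkin_indep.
    move=> B cB; split; first exact: cyl_of_measurable cB.
    by rewrite setIC muleC; apply: (H B cB _ _).2; exact: sigma_of_cyl.
  move=> /(_ A2 (sigma_of_cyl s2)) [_]; by rewrite setIC muleC.
move=> cB; apply: smallest_sub.
  by apply: dynkin_indep; exact: cyl_of_measurable cB.
move=> A cA; split; first exact: cyl_of_measurable cA.
exact: indep_cyl J12 cA cB.
Qed.

(* [g_sigma_algebraType] turns [sigma_of J] into the sigma-algebra of a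
   measurable type, so that the library's closure lemmas for measurable
   functions apply to functions of the variables indexed by [J]. *)
Definition Tsig (J : set I) := g_sigma_algebraType (gen_of J).

Lemma measurable_sigma J d' (T' : measurableType d') (f : T -> T') (B : set T') :
  measurable_fun setT (f : Tsig J -> T') -> measurable B -> sigma_of J (f @^-1` B).
Proof. by move=> mf mB; have := mf measurableT B mB; rewrite setTI. Qed.

Lemma measurable_Tsig J i : J i -> measurable_fun setT (F i : Tsig J -> R).
Proof.
move=> Ji _ B mB; rewrite setTI; apply: sub_sigma_algebra; by exists i, B.
Qed.

Lemma Tsig_measurable J d' (T' : measurableType d') (f : T -> T') :
  measurable_fun setT (f : Tsig J -> T') -> measurable_fun setT f.
Proof.
by move=> mf _ B mB; rewrite setTI; apply: (@sigma_of_measurable J); exact: measurable_sigma.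
Qed.

(** This is the substitute for conditioning on [f]. The joint law agrees with the product of the
    marginals on rectangles, hence everywhere, and a product measure is the integral of the measures
    of its slices. *)
Lemma indep_pair J1 J2 d1 d2 (T1 : measurableType d1) (T2 : measurableType d2)
    (f : T -> T1) (g : T -> T2) (Z : set (T1 * T2)) : J1 `&` J2 = set0 ->
  measurable_fun setT (f : Tsig J1 -> T1) ->
  measurable_fun setT (g : Tsig J2 -> T2) -> measurable Z ->
  P [set w | Z (f w, g w)] = (\int[P]_w P [set w' | Z (f w, g w')])%E.
Proof.
move=> J12 mf mg mZ.
have mf' := Tsig_measurable mf; have mg' := Tsig_measurable mg.
pose f' : {RV P >-> T1} := HB.pack f (isMeasurableFun.Build _ _ _ _ f mf').
pose g' : {RV P >-> T2} := HB.pack g (isMeasurableFun.Build _ _ _ _ g mg').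
pose h w := (f w, g w).
have mh : measurable_fun setT h by exact: measurable_fun_pair.
pose h' : {RV P >-> (T1 * T2)%type} := HB.pack h (isMeasurableFun.Build _ _ _ _ h mh).
transitivity ((distribution P f' \x distribution P g')%E Z).
  apply/esym/(@product_measure_unique _ _ _ _ R _ _ (distribution P h')) => //.
  move=> A B mA mB; rewrite /distribution /pushforward /=.
  have sA : sigma_of J1 (f @^-1` A) by exact: measurable_sigma.
  have sB : sigma_of J2 (g @^-1` B) by exact: measurable_sigma.
  rewrite [X in P X = _](_ : _ = f @^-1` A `&` g @^-1` B)//.
  have mA' := sigma_of_measurable sA; have mB' := sigma_of_measurable sB.
  rewrite !prE//; last exact: measurableI.
  by rewrite (indep_sigma J12)// EFinM.
rewrite /product_measure1 ge0_integral_distribution//; last exact: measurable_fun_xsection.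
apply: eq_integral => w _ /=; congr (P _).
by apply/seteqP; split => w' /=; rewrite /xsection /= inE.
Qed.

End independence.

Section independence_groups.
Context d (T : measurableType d) (R : realType) (P : probability T R).
Context (I : choiceType) (F : I -> T -> R).
Hypothesis mF : forall i, measurable_fun setT (F i).
Hypothesis indF : mutually_independent P F.

Lemma sigma_of_bigcap (K : choiceType) (J : set I) (s : seq K) (A : K -> set T) :
  (forall k, k \in s -> sigma_of F J (A k)) ->
  sigma_of F J (\bigcap_(k in [set` s]) A k).
Proof.
move=> sA; apply: (@fin_bigcap_measurable _ (Tsig F J)); first exact: finite_seq.
by move=> k; exact: sA.
Qed.

Lemma indep_groups (K : choiceType) (J : K -> set I) (s : seq K) (A : K -> set T) :
  uniq s -> (forall k k', k != k' -> J k `&` J k' = set0) ->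
  (forall k, sigma_of F (J k) (A k)) ->
  pr P (\bigcap_(k in [set` s]) A k) = \prod_(k <- s) pr P (A k).
Proof.
move=> + disJ sA; elim: s => [_|k s ih /= /andP[ks us]].
  by rewrite big_nil set_nil bigcap_set0 prT.
have -> : [set` k :: s] = [set k] `|` [set` s].
  apply/seteqP; split => i /=; first by rewrite inE => /predU1P.
  by rewrite inE => /predU1P.
rewrite big_cons -ih// bigcap_setU1.
apply: (indep_sigma mF indF (J1 := J k) (J2 := \bigcup_(k' in [set` s]) J k')) => //.
  rewrite -subset0 => i [Jki [k' /= k's Jk'i]].
  have kk' : k != k' by apply: contraNneq ks => ->.
  by have := conj Jki Jk'i : (J k `&` J k') i; rewrite disJ.
apply: sigma_of_bigcap => k' k's.
by apply: (sigma_of_sub _ (sA k')) => i Ji; exists k'.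
Qed.

Lemma measurable_indep_slice J1 J2 d1 d2 (T1 : measurableType d1)
    (T2 : measurableType d2) (f : T -> T1) (g : T -> T2) (Z : set (T1 * T2)) :
  measurable_fun setT (f : Tsig F J1 -> T1) ->
  measurable_fun setT (g : Tsig F J2 -> T2) -> measurable Z ->
  measurable_fun setT (P \o (fun w => [set w' | Z (f w, g w')])).
Proof.
move=> mf mg mZ.
have mf' := Tsig_measurable mF mf; have mg' := Tsig_measurable mF mg.
pose g' : {RV P >-> T2} := HB.pack g (isMeasurableFun.Build _ _ _ _ g mg').
rewrite (_ : P \o _ = (fun t => distribution P g' (xsection Z t)) \o f); last first.
  apply/funext => w /=; rewrite /distribution /pushforward; congr (P _).
  by apply/seteqP; split => w' /=; rewrite /xsection /= inE.
apply: measurableT_comp mf'.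
exact: measurable_fun_xsection.
Qed.

End independence_groups.

(** * Exponential tails and memorylessness *)

Section exponential_law.
Context d (T : measurableType d) (R : realType) (P : probability T R).

(** The maximum with 0 makes one formula valid for thresholds of either sign, so that differences
    such as [y - W w] can be substituted without a case distinction. *)
Definition exp_tail (r : R) (V : T -> R) :=
  forall x, pr P [set w | x < V w] = expR (- r * Num.max 0 x).

Lemma exponential_prob_le0 (r : R) : 0 < r ->
  exponential_prob r `]-oo, (0:R)] = 0%E.
Proof.
move=> r0; rewrite /exponential_prob -integral_itv_bndo_bndc; last first.
  by apply/measurable_funTS/measurable_EFinP; exact: measurable_exponential_pdf.
apply: integral0_eq => x /=; rewrite in_itv /= => x0.
by rewrite lt0_exponential_pdf.
Qed.

Lemma exp_distributed_tail (r : R) (V : {RV P >-> R}) : 0 < r ->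
  exp_distributed r V -> exp_tail r V.
Proof.
move=> r0 hV x.
have mV A : measurable A -> measurable (V @^-1` A).
  by move=> mA; rewrite -[X in measurable X]setTI; exact: measurable_funP.
have p0 : pr P (V @^-1` `]-oo, 0]%classic) = 0.
  have := hV `]-oo, 0]%classic (measurable_itv _).
  by rewrite exponential_prob_le0// /pr /distribution /pushforward => ->.
have <- : pr P (V @^-1` `]x, +oo[%classic) = pr P [set w | x < V w].
  by congr (pr P _); apply/seteqP; split => w /=; rewrite in_itv/= andbT.
have := prDI P measurableT (mV _ (measurable_itv `]-oo, x])).
rewrite setTI setTD prT preimage_setC setCitvl.
have [x0|x0] := leP x 0.
  rewrite mulr0 expR0.
  have : pr P (V @^-1` `]-oo, x]%classic) <= 0.
    rewrite -p0; apply: le_pr; [exact: mV|exact: mV|].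
    by move=> w /=; rewrite !in_itv/= => /le_trans; exact.
  by have := pr_ge0 P (V @^-1` `]-oo, x]%classic); lra.
have : pr P (V @^-1` `[0, x]%classic) = 1 - expR (- r * x).
  have := hV `[0, x]%classic (measurable_itv _); rewrite exponential_prob_itv0c//.
  by rewrite /pr /distribution /pushforward => ->.
have : pr P (V @^-1` `[0, x]%classic) <= pr P (V @^-1` `]-oo, x]%classic).
  apply: le_pr; [exact: mV|exact: mV|].
  by move=> w /=; rewrite !in_itv/= => /andP[].
have : pr P (V @^-1` `]-oo, x]%classic) <=
    pr P (V @^-1` `]-oo, 0]%classic `|` V @^-1` `[0, x]%classic).
  apply: le_pr; [exact: mV|by apply: measurableU; exact: mV|].
  move=> w /=; rewrite !in_itv/= => ->; rewrite andbT.
  by have [] := leP (V w) 0; [left|right; exact: ltW].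
have := prI_inclusion_exclusion P (mV _ (measurable_itv `]-oo, 0])) (mV _ (measurable_itv `[0, x])).
by have := pr_ge0 P (V @^-1` `]-oo, 0]%classic `&` V @^-1` `[0, x]%classic); lra.
Qed.

Lemma exp_distributed_tail_ge (r : R) (V : {RV P >-> R}) x : 0 < r ->
  exp_distributed r V -> pr P [set w | x <= V w] = expR (- r * Num.max 0 x).
Proof.
move=> r0 hV; rewrite -(exp_distributed_tail r0 hV x).
have mA : measurable (V @^-1` [set x]).
  by rewrite -[X in measurable X]setTI; exact: measurable_funP.
have mB : measurable [set w | x < V w].
  have -> : [set w | x < V w] = V @^-1` `]x, +oo[%classic.
    by apply/seteqP; split => w /=; rewrite in_itv/= andbT.
  by rewrite -[X in measurable X]setTI; exact: measurable_funP.
have -> : [set w | x <= V w] = [set w | x < V w] `|` V @^-1` [set x].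
  apply/seteqP; split => w /=; rewrite le_eqVlt.
    by move=> /orP[/eqP|]; [right|left].
  by move=> [->|->]; rewrite ?orbT ?eqxx.
have := prI_inclusion_exclusion P mB mA.
have -> : pr P (V @^-1` [set x]) = 0.
  have := hV [set x] (measurable_set1 x).
  by rewrite /exponential_prob integral_set1 /pr /distribution /pushforward => ->.
rewrite (_ : _ `&` _ = set0); last first.
  by apply/seteqP; split => w //= [+ e]; rewrite e ltxx.
by rewrite {1}/pr measure0 /=; lra.
Qed.

End exponential_law.

(** * Memorylessness at a random time, and preempted exponential times *)

Section memoryless.
Context d (T : measurableType d) (R : realType) (P : probability T R).
Context (I : choiceType) (F : I -> T -> R).
Hypothesis mF : forall i, measurable_fun setT (F i).
Hypothesis indF : mutually_independent P F.

Lemma measurable_lt_set d' (T' : measurableType d') (f g : T' -> R) :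
  measurable_fun setT f -> measurable_fun setT g -> measurable [set w | f w < g w].
Proof.
move=> mf mg; rewrite -[X in measurable X]setTI.
by have := measurable_fun_ltr mf mg; apply.
Qed.

Lemma measurable_le_set d' (T' : measurableType d') (f g : T' -> R) :
  measurable_fun setT f -> measurable_fun setT g -> measurable [set w | f w <= g w].
Proof.
move=> mf mg; rewrite -[X in measurable X]setTI.
by have := measurable_fun_ler mf mg; apply.
Qed.

Context (r : R) (V : T -> R) (J1 J2 J3 : set I).
Hypothesis r0 : 0 < r.
Hypothesis V_gt : exp_tail P r V.
Hypothesis V_ge : forall x, pr P [set w | x <= V w] = expR (- r * Num.max 0 x).
Hypothesis mV : measurable_fun setT (V : Tsig F J2 -> R).
Hypotheses (J12 : J1 `&` J2 = set0) (J13 : J1 `&` J3 = set0) (J23 : J2 `&` J3 = set0).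

(** For a fixed value [v] of [W], [V] has to pass the larger of [u] and [y + u - v], which is [u]
    plus the larger of 0 and [y - v]. The exponential turns this sum into the product. *)
Lemma exp_memoryless_shift (W : T -> R) (u y : R) : 0 <= u ->
  measurable_fun setT (W : Tsig F J3 -> R) ->
  pr P [set w | u <= V w /\ y + u < V w + W w] =
  expR (- r * u) * pr P [set w | y < V w + W w].
Proof.
move=> u0 mW.
have mV' := Tsig_measurable mF mV; have mW' := Tsig_measurable mF mW.
have m1 : measurable [set w | y < V w + W w].
  by apply: measurable_lt_set => //; exact: measurable_funD.
have m2 : measurable [set w | u <= V w /\ y + u < V w + W w].
  apply: (measurableI [set w | u <= V w] [set w | y + u < V w + W w]).
    exact: measurable_le_set.
  by apply: measurable_lt_set => //; exact: measurable_funD.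
pose Z (a b : R) : set (R * R) := [set p | a <= p.2 /\ b < p.2 + p.1].
have mZ a b : measurable (Z a b).
  apply: (measurableI [set p : R * R | a <= p.2] [set p : R * R | b < p.2 + p.1]).
    exact: measurable_le_set.
  by apply: measurable_lt_set => //; exact: measurable_funD.
have J32 : J3 `&` J2 = set0 by rewrite setIC.
have h (a b : R) w : P [set w' | Z a b (W w, V w')] =
    (expR (- r * Num.max (Num.max 0 a) (b - W w)))%:E.
  rewrite prE; last first.
    apply: (measurableI [set w' | a <= V w'] [set w' | b < V w' + W w]).
      exact: measurable_le_set.
    by apply: measurable_lt_set => //; exact: measurable_funD.
  have [ab|ab] := leP a (b - W w).
    have -> : [set w' | Z a b (W w, V w')] = [set w' | b - W w < V w'].
      apply/seteqP; split => w' /=; rewrite /Z /=; first by move=> []; lra.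
      by move=> ?; split; lra.
    by rewrite V_gt -maxA (max_idPr ab).
  have -> : [set w' | Z a b (W w, V w')] = [set w' | a <= V w'].
    apply/seteqP; split => w' /=; rewrite /Z /=; first by move=> [].
    by move=> ?; split; lra.
  by rewrite V_ge -maxA (max_idPl (ltW ab)).
apply: EFin_inj; rewrite EFinM -!prE//.
have e1 := indep_pair mF indF J32 mW mV (mZ u (y + u)).
have e2 := indep_pair mF indF J32 mW mV (mZ 0 y).
rewrite [LHS]e1; clear e1.
(* The slices of [Z 0 y] carry the extra condition [0 <= V], which has probability one. *)
have -> : P [set w | y < V w + W w] = (\int[P]_w P [set w' | Z 0%R y (W w, V w')])%E.
  have mZ0 : measurable [set w | Z 0 y (W w, V w)].
    apply: (measurableI [set w | 0 <= V w] [set w | y < V w + W w]) => //.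
    exact: measurable_le_set.
  rewrite -e2 !prE//; congr (_%:E).
  have mo : measurable [set w | 0 <= V w] by exact: measurable_le_set.
  apply: (eq_pr_on mo) => //.
    by rewrite prE// V_ge maxxx mulr0 expR0.
  by move=> w /= V0; split => [|[]].
rewrite -ge0_integralZl_EFin ?expR_ge0//; last first.
  exact: (measurable_indep_slice P mF mW mV (mZ 0 y)).
apply: eq_integral => w _; rewrite !h -EFinM -expRD; congr ((expR _)%:E).
rewrite maxxx -mulrDr; congr (_ * _); rewrite (max_idPr u0).
by rewrite addr_maxr addr0; congr Num.max; lra.
Qed.

(** The threshold may be random as long as it is independent of [V] and [W]. Because of the
    condition [0 < Q], a negative value of [Q] can encode an excluded outcome; [pr_resid] uses this
    to bring in an event of the past. *)
Lemma exp_memoryless (Q W : T -> R) (y : R) :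
  measurable_fun setT (Q : Tsig F J1 -> R) ->
  measurable_fun setT (W : Tsig F J3 -> R) ->
  pr P [set w | [/\ 0 < Q w, Q w <= V w & y + Q w < V w + W w]] =
  pr P [set w | 0 < Q w /\ Q w <= V w] * pr P [set w | y < V w + W w].
Proof.
move=> mQ mW.
have mV' := Tsig_measurable mF mV; have mW' := Tsig_measurable mF mW.
have mQ' := Tsig_measurable mF mQ.
have J123 : J1 `&` (J2 `|` J3) = set0 by rewrite setIUr J12 J13 setU0.
have mVW : measurable_fun setT ((fun w => (V w, W w)) : Tsig F (J2 `|` J3) -> R * R).
  apply: measurable_fun_pair => _ B mB; rewrite setTI.
    apply: (@sigma_of_sub _ _ _ _ F J2); first by move=> ?; left.
    exact: (measurable_sigma mV).
  apply: (@sigma_of_sub _ _ _ _ F J3); first by move=> ?; right.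
  exact: (measurable_sigma mW).
pose Z1 : set (R * (R * R)) := [set p | [/\ 0 < p.1, p.1 <= p.2.1 & y + p.1 < p.2.1 + p.2.2]].
pose Z2 : set (R * (R * R)) := [set p | 0 < p.1 /\ p.1 <= p.2.1].
have m21 : measurable_fun setT (fun p : R * (R * R) => p.2.1).
  exact: measurableT_comp.
have m22 : measurable_fun setT (fun p : R * (R * R) => p.2.2).
  exact: measurableT_comp.
have mZ2 : measurable Z2.
  apply: (measurableI [set p : R * (R * R) | 0 < p.1] [set p : R * (R * R) | p.1 <= p.2.1]).
    exact: measurable_lt_set.
  exact: measurable_le_set.
have Z12 : Z1 = Z2 `&` [set p | y + p.1 < p.2.1 + p.2.2].
  by apply/seteqP; split => p; rewrite /Z1 /Z2 /=; [move=> [? ? ?]|move=> [[? ?] ?]].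
have mZ1 : measurable Z1.
  rewrite Z12; apply: measurableI => //.
  by apply: measurable_lt_set; exact: measurable_funD.
apply: EFin_inj; rewrite EFinM -!prE; first last.
- rewrite [X in measurable X](_ : _ = (fun w => (Q w, (V w, W w))) @^-1` Z1)//.
  rewrite -[X in measurable X]setTI; apply: measurable_fun_pair => //.
  exact: measurable_fun_pair.
- rewrite [X in measurable X](_ : _ = (fun w => (Q w, (V w, W w))) @^-1` Z2)//.
  rewrite -[X in measurable X]setTI; apply: measurable_fun_pair => //.
  exact: measurable_fun_pair.
- by apply: measurable_lt_set => //; exact: measurable_funD.
have e1 := indep_pair mF indF J123 mQ mVW mZ1.
have e2 := indep_pair mF indF J123 mQ mVW mZ2.
rewrite [LHS]e1 [X in (X * _)%E](_ : _ = (\int[P]_w P [set w' | Z2 (Q w, (V w', W w'))])%E)//.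
rewrite -ge0_integralZr//; last first.
  exact: (measurable_indep_slice P mF mQ mVW mZ2).
apply: eq_integral => w _.
have [Q0|Q0] := ltP 0 (Q w); last first.
  have -> : [set w' | Z1 (Q w, (V w', W w'))] = set0.
    by apply/seteqP; split => // w'; rewrite /Z1 /= => -[]; rewrite ltNge Q0.
  have -> : [set w' | Z2 (Q w, (V w', W w'))] = set0.
    by apply/seteqP; split => // w'; rewrite /Z2 /= => -[]; rewrite ltNge Q0.
  by rewrite measure0 mul0e.
have -> : [set w' | Z1 (Q w, (V w', W w'))] =
    [set w' | Q w <= V w' /\ y + Q w < V w' + W w'].
  by apply/seteqP; split => w'; rewrite /Z1 /= => -[].
have -> : [set w' | Z2 (Q w, (V w', W w'))] = [set w' | Q w <= V w'].
  by apply/seteqP; split => w'; rewrite /Z2 /= => -[].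
rewrite !prE.
- by rewrite exp_memoryless_shift ?(ltW Q0)// -EFinM V_ge (max_idPr (ltW Q0)).
- by apply: measurable_lt_set => //; exact: measurable_funD.
- exact: measurable_le_set.
- apply: (measurableI [set w' | Q w <= V w'] [set w' | y + Q w < V w' + W w']).
    exact: measurable_le_set.
  by apply: measurable_lt_set => //; exact: measurable_funD.
Qed.

(* Conditionally on [X = x], the tail of the right-hand variable at [y >= 0] is
   [exp (- r y)] whatever [x] is. *)
Lemma exp_tail_preempt (X D : T -> R) :
  measurable_fun setT (X : Tsig F J1 -> R) ->
  measurable_fun setT (D : Tsig F J3 -> R) ->
  exp_tail P r D ->
  exp_tail P r (fun w => if V w < X w then V w else Num.max 0 (X w) + D w).
Proof.
move=> mX mD D_gt.
have mV' := Tsig_measurable mF mV; have mD' := Tsig_measurable mF mD.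
have mX' := Tsig_measurable mF mX.
have J123 : J1 `&` (J2 `|` J3) = set0 by rewrite setIUr J12 J13 setU0.
have mVD : measurable_fun setT ((fun w => (V w, D w)) : Tsig F (J2 `|` J3) -> R * R).
  apply: measurable_fun_pair => _ B mB; rewrite setTI.
    apply: (@sigma_of_sub _ _ _ _ F J2); first by move=> ?; left.
    exact: (measurable_sigma mV).
  apply: (@sigma_of_sub _ _ _ _ F J3); first by move=> ?; right.
  exact: (measurable_sigma mD).
pose f (p : R * (R * R)) := if p.2.1 < p.1 then p.2.1 else Num.max 0 p.1 + p.2.2.
have mf : measurable_fun setT f.
  apply: measurable_fun_ifT => //.
  - by apply: measurable_fun_ltr => //; exact: measurableT_comp.
  - exact: measurableT_comp.
  - apply: measurable_funD; last exact: measurableT_comp.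
    exact: measurable_maxr.
have mfw y : measurable [set w | y < f (X w, (V w, D w))].
  apply: measurable_lt_set => //; apply: measurableT_comp => //.
  by apply: measurable_fun_pair => //; exact: measurable_fun_pair.
suff main y : 0 <= y -> pr P [set w | y < f (X w, (V w, D w))] = expR (- r * y).
  move=> y; have [y0|y0] := leP 0 y; first exact: main.
  rewrite mulr0 expR0; apply/le_anti/andP; split; first exact: pr_le1.
  have := main 0 (lexx _); rewrite mulr0 expR0 => <-.
  by apply: le_pr => // w /=; exact: lt_trans.
move=> y0; apply: EFin_inj; rewrite -prE//.
pose Z : set (R * (R * R)) := [set p | y < f p].
have mZ : measurable Z by exact: measurable_lt_set.
rewrite [LHS](indep_pair mF indF J123 mX mVD mZ).
transitivity (\int[P]_w (expR (- r * y))%:E)%E; last first.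
  by rewrite integral_cst// [X in (_ * X)%E]probability_setT mule1.
apply: eq_integral => w _; rewrite /Z /f /=.
set x := X w.
have ma : measurable [set w' | V w' < x /\ y < V w'].
  by apply: (measurableI [set w' | V w' < x] [set w' | y < V w']); exact: measurable_lt_set.
have sb : sigma_of F J2 [set w' | x <= V w'].
  exact: (@measurable_le_set _ (Tsig F J2)).
have sc : sigma_of F J3 [set w' | y < Num.max 0 x + D w'].
  apply: (@measurable_lt_set _ (Tsig F J3)) => //; exact: measurable_funD.
have mb := sigma_of_measurable mF sb; have mc := sigma_of_measurable mF sc.
have -> : [set w' | y < (if V w' < x then V w' else Num.max 0 x + D w')] =
    [set w' | V w' < x /\ y < V w'] `|`
    ([set w' | x <= V w'] `&` [set w' | y < Num.max 0 x + D w']).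
  apply/seteqP; split => w' /=.
    by have [Vx|xV] := ltP (V w') x; [left|right].
  by move=> [[-> //]|[xV]]; rewrite (ltNge (V w')) xV.
have mbc := measurableI _ _ mb mc.
rewrite prE; last exact: measurableU.
congr (_%:E).
have := prI_inclusion_exclusion P ma mbc.
rewrite (_ : _ `&` _ = set0); last first.
  by apply/seteqP; split => // w' /= [[Vx _] [xV _]]; move: Vx; rewrite ltNge xV.
rewrite (indep_sigma mF indF J23 sb sc) V_ge.
have -> : pr P set0 = 0 by rewrite /pr measure0.
have -> : pr P [set w' | y < Num.max 0 x + D w'] = expR (- r * Num.max 0 (y - Num.max 0 x)).
  by rewrite -D_gt; congr pr; apply/seteqP; split => w' /=; lra.
have [x0|x0] := leP x 0.
  rewrite subr0 (max_idPr y0) mulr0 expR0 mul1r.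
  suff -> : pr P [set w' | V w' < x /\ y < V w'] = 0 by lra.
  by rewrite (_ : mkset _ = set0) ?/pr ?measure0//; apply/seteqP; split => w' //= -[]; lra.
(* For [0 < x <= y] only the preempted branch can exceed [y], and the exponents [x] and [y - x] add
   up. For [x > y] the preempted branch exceeds [y] with probability one, and both branches together
   make up the event [y < V]. *)
have [xy|xy] := leP x y.
  rewrite (_ : [set w' | _ /\ _] = set0); last by apply/seteqP; split => w' //= -[]; lra.
  rewrite /pr measure0 /= (max_idPr _) ?subr_ge0// -expRD -mulrDr (_ : x + (y - x) = y); last by lra.
  by lra.
rewrite (max_idPl _); last by rewrite subr_le0 ltW.
rewrite mulr0 expR0 mulr1.
have mVy : measurable [set w' | y < V w'] by exact: measurable_lt_set.
have := prDI P mVy mb; rewrite V_gt (max_idPr y0).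
have -> : [set w' | y < V w'] `&` [set w' | x <= V w'] = [set w' | x <= V w'].
  by apply/seteqP; split => w' /=; [case|move=> ?; split => //; lra].
have -> : [set w' | y < V w'] `\` [set w' | x <= V w'] = [set w' | V w' < x /\ y < V w'].
  apply/seteqP; split => w' /=; first by move=> [yV /negP]; rewrite -ltNge.
  by move=> [Vx yV]; split => //; apply/negP; rewrite -ltNge.
by rewrite V_ge (max_idPr (ltW x0)); lra.
Qed.

End memoryless.

(** * The sum of two independent exponential times *)

Section hypoexponential.
Context (R : realType).
Implicit Types (r q y u h : R) (G : R -> R).

(** Tail of the hypoexponential law; for equal rates it is the Erlang law with two stages. *)
Definition hypo r q y : R :=
  if r == q then (1 + r * y) * expR (- r * y)
  else (q * expR (- r * y) - r * expR (- q * y)) / (q - r).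

Lemma is_derive_expRM r y : is_derive y 1 (fun x => expR (- r * x)) (- r * expR (- r * y)).
Proof.
have h : is_derive y 1 (fun x : R => - r * x) (- r).
  by apply: is_derive_eq; rewrite /= /GRing.scale /= mulr1.
by have := is_derive1_comp (is_derive_expR (- r * y)) h; rewrite mulrC.
Qed.

(** This equation serves twice: it gives derivative 0 at 0, hence the flat start, and it drives the
    recursion for the integral of [g ^ n]. *)
Lemma is_derive_hypo r q y :
  is_derive y 1 (hypo r q) (- q * (hypo r q y - expR (- r * y))).
Proof.
have h1 := is_derive_expRM r y; have h2 := is_derive_expRM q y.
rewrite /hypo; case: eqVneq => [->|rq].
  apply: is_derive_eq; rewrite /= /GRing.scale /=; ring.
have qr : q - r != 0 by rewrite subr_eq0 eq_sym.
apply: is_derive_eq; rewrite /= /GRing.scale /=; field.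
by [].
Qed.

Lemma hypoC r q : hypo r q = hypo q r.
Proof.
apply/funext => y; rewrite /hypo eq_sym; case: eqVneq => [->//|qr].
have rq0 : r - q != 0 by rewrite subr_eq0 eq_sym.
have qr0 : q - r != 0 by rewrite subr_eq0.
by field; rewrite qr0 rq0.
Qed.

Lemma hypo0 r q : hypo r q 0 = 1.
Proof.
rewrite /hypo !mulr0 expR0 addr0 !mulr1; case: eqVneq => // rq.
by rewrite divff// subr_eq0 eq_sym.
Qed.

(* Split [u + h] at time [u], according to whether the first stage is over:
   this functional equation and a flat start characterize [hypo]. *)
Definition hypo_eq r q G := forall u h, 0 <= u -> 0 <= h ->
  G (u + h) = expR (- r * u) * G h + expR (- q * h) * (G u - expR (- r * u)).

Definition flat_start G :=
  forall y, 0 < y -> k.+1%:R * (1 - G (y / k.+1%:R)) @[k --> \oo] --> 0.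

Lemma hypo_hypo_eq r q : hypo_eq r q (hypo r q).
Proof.
move=> u h u0 h0; rewrite /hypo; case: eqVneq => [->|rq].
  by rewrite [- q * (u + h)]mulrDr expRD; ring.
have qr : q - r != 0 by rewrite subr_eq0 eq_sym.
by rewrite !mulrDr !expRD; field.
Qed.

Lemma hypo_flat_start r q : flat_start (hypo r q).
Proof.
move=> y y0.
have := is_derive_hypo r q 0; rewrite hypo0 mulr0 expR0 subrr mulr0 => -[dh eh].
have : h^-1 *: (hypo r q (h *: 1 + 0) - hypo r q 0) @[h --> 0^'] --> 'D_1 (hypo r q) 0.
  exact: dh.
rewrite eh.
move/cvgrPdist_lt => H; apply/cvgrPdist_lt => e e0.
have /= := H (e / y); rewrite divr_gt0// => /(_ isT) [c /= c0 hc].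
near=> k.
have k0 : 0 < k.+1%:R :> R by [].
have yk0 : 0 < y / k.+1%:R by rewrite divr_gt0.
have h1 : `|0 - y / k.+1%:R| < c.
  rewrite sub0r normrN gtr0_norm// ltr_pdivrMr// mulrC -ltr_pdivrMr//.
  near: k; exists (Num.truncn (y / c)) => // m /= ym.
  by rewrite (lt_le_trans (truncnS_gt _))// ler_nat.
have := hc _ h1; rewrite /= gt_eqF// => /(_ isT).
rewrite hypo0 addr0 [_ *: 1]mulr1 invf_div sub0r normrN [_ *: _]mulrC => hk.
rewrite sub0r normrN.
have -> : `|k.+1%:R * (1 - hypo r q (y / k.+1%:R))| =
    `|(hypo r q (y / k.+1%:R) - 1) * (k.+1%:R / y)| * y.
  rewrite !normrM distrC (gtr0_norm k0) normfV (gtr0_norm y0); field.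
  by rewrite gt_eqF.
by rewrite -ltr_pdivlMr.
Unshelve. all: by end_near. Qed.

(** The equation is affine with coefficients at most 1, so the absolute difference of two solutions
    is subadditive. Its value at [y] is at most [k + 1] times its value at [y / (k + 1)], and this
    product tends to 0 by the flat starts. No regularity of [G1] and [G2] away from 0 is
    involved. *)
Lemma hypo_eq_unique r q G1 G2 : 0 < r -> 0 < q ->
  hypo_eq r q G1 -> hypo_eq r q G2 -> flat_start G1 -> flat_start G2 ->
  G1 0 = G2 0 -> forall y, 0 <= y -> G1 y = G2 y.
Proof.
move=> r0 q0 e1 e2 f1 f2 G0 y; rewrite le_eqVlt => /predU1P[<-//|y0].
pose e x := G1 x - G2 x.
have expR_le1N a x : 0 < a -> 0 <= x -> `|expR (- a * x)| <= 1.
  move=> a0 x0; rewrite ger0_norm ?expR_ge0// -expR0 ler_expR.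
  by rewrite mulNr oppr_le0 mulr_ge0// ltW.
have sub u h : 0 <= u -> 0 <= h -> `|e (u + h)| <= `|e h| + `|e u|.
  move=> u0 h0; rewrite /e (e1 _ _ u0 h0) (e2 _ _ u0 h0).
  rewrite (_ : _ - _ = expR (- r * u) * (G1 h - G2 h) + expR (- q * h) * (G1 u - G2 u)); last by ring.
  rewrite (le_trans (ler_normD _ _))// lerD// normrM ler_piMl//; exact: expR_le1N.
have mul k h : 0 <= h -> `|e (k%:R * h)| <= k%:R * `|e h|.
  move=> h0; elim: k => [|k ih]; first by rewrite !mul0r /e G0 subrr normr0.
  rewrite -natr1 !mulrDl !mul1r (le_trans (sub _ _ _ _))//; first exact: mulr_ge0.
  by rewrite addrC lerD2r.
have lim : k.+1%:R * (G2 (y / k.+1%:R) - G1 (y / k.+1%:R)) @[k --> \oo] --> 0.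
  rewrite -[X in _ --> X](subrr (0 : R)).
  rewrite (_ : (fun k => _) = (fun k => k.+1%:R * (1 - G1 (y / k.+1%:R))) \-
    (fun k => k.+1%:R * (1 - G2 (y / k.+1%:R)))); last by apply/funext => k /=; ring.
  by apply: cvgB; [exact: f1|exact: f2].
apply/eqP; rewrite -subr_eq0 -normr_eq0 -/(e y); apply/eqP.
suff : `|e y| <= 0 by move=> h; apply/le_anti; rewrite h normr_ge0.
have /cvg_norm := lim; rewrite normr0 => {}lim.
rewrite -(cvg_lim _ lim)//; apply: limr_ge; first by apply/cvg_ex; exists 0.
near=> k; rewrite normrM gtr0_norm//.
have {1}-> : y = k.+1%:R * (y / k.+1%:R) by field.
by rewrite (distrC (G2 _)); apply: mul; rewrite divr_ge0// ltW.
Unshelve. all: by end_near. Qed.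

End hypoexponential.

(** * Law of the sum of two independent exponential times, by its functional equation *)

Section exponential_sum.
Context d (T : measurableType d) (R : realType) (P : probability T R).
Context (I : choiceType) (F : I -> T -> R).
Hypothesis mF : forall i, measurable_fun setT (F i).
Hypothesis indF : mutually_independent P F.
Context (r q : R) (V W : T -> R) (J1 J2 : set I).
Hypotheses (r0 : 0 < r) (q0 : 0 < q).
Hypothesis V_gt : exp_tail P r V.
Hypothesis V_ge : forall x, pr P [set w | x <= V w] = expR (- r * Num.max 0 x).
Hypothesis W_gt : exp_tail P q W.
Hypothesis mV : measurable_fun setT (V : Tsig F J1 -> R).
Hypothesis mW : measurable_fun setT (W : Tsig F J2 -> R).
Hypothesis J12 : J1 `&` J2 = set0.

Let mV' := Tsig_measurable mF mV.
Let mW' := Tsig_measurable mF mW.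

Let G y := pr P [set w | y < V w + W w].

Let mG y : measurable [set w | y < V w + W w].
Proof. by apply: measurable_lt_set => //; exact: measurable_funD. Qed.

Let sV y : sigma_of F J1 [set w | y < V w].
Proof. exact: (@measurable_lt_set _ _ (Tsig F J1)). Qed.

Let sW y : sigma_of F J2 [set w | y < W w].
Proof. exact: (@measurable_lt_set _ _ (Tsig F J2)). Qed.

(** For positive stages, a sum of at most [h] forces both stages to be at most [h], and each of
    these independent events has probability at most its rate times [h]. Being quadratic, the bound
    gives the flat start. *)
Let G_ge h : 0 <= h -> 1 - G h <= r * q * h ^+ 2.
Proof.
move=> h0.
have mv y := sigma_of_measurable mF (sV y); have mw y := sigma_of_measurable mF (sW y).
pose O := [set w | 0 < V w] `&` [set w | 0 < W w].
have mO : measurable O by exact: measurableI.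
have PO : P O = 1%E.
  rewrite prE// (indep_sigma mF indF J12 (sV 0) (sW 0)) V_gt W_gt maxxx !mulr0 expR0.
  by rewrite mulr1.
pose A := ([set w | h < V w] `|` [set w | h < W w]) `&` O.
have mA : measurable A by apply: measurableI => //; exact: measurableU.
have : pr P A <= G h.
  apply: le_pr => // w [+ [/= V0 W0]] => -[] /=; lra.
have -> : pr P A = pr P ([set w | h < V w] `|` [set w | h < W w]).
  apply: (eq_pr_on mO) => //; first exact: measurableU.
  by move=> w Ow; split => [[]|].
have := prI_inclusion_exclusion P (mv h) (mw h).
rewrite (indep_sigma mF indF J12 (sV h) (sW h)) V_gt W_gt (max_idPr h0).
have := expR_ge1Dx (- r * h); have := expR_ge1Dx (- q * h).
have : expR (- r * h) <= 1 by rewrite -expR0 ler_expR mulNr oppr_le0 mulr_ge0// ltW.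
have : expR (- q * h) <= 1 by rewrite -expR0 ler_expR mulNr oppr_le0 mulr_ge0// ltW.
set a := expR _; set b := expR _ => a1 b1 ha hb hAB hG.
have : (1 - a) * (1 - b) <= (q * h) * (r * h) by apply: ler_pM; lra.
rewrite (_ : r * q * h ^+ 2 = (q * h) * (r * h)); last by ring.
by rewrite mulrBl mul1r mulrBr mulr1; lra.
Qed.

Let G_le1 y : G y <= 1. Proof. exact: pr_le1. Qed.

Let G0 : G 0 = 1.
Proof.
have := G_ge (lexx 0); rewrite expr0n mulr0 => h.
by apply/le_anti; rewrite G_le1; lra.
Qed.

Let G_flat : flat_start G.
Proof.
move=> y y0.
apply: (@squeeze_cvgr _ _ _ _ (fun=> 0) (fun k => r * q * y ^+ 2 * harmonic k)).
- near=> k; have k0 : 0 < k.+1%:R :> R by [].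
  apply/andP; split; first by rewrite mulr_ge0// subr_ge0.
  have h0 : 0 <= y / k.+1%:R by rewrite divr_ge0// ltW.
  have := G_ge h0; rewrite -(ler_pM2l k0) => /le_trans; apply.
  by rewrite le_eqVlt; apply/orP; left; apply/eqP; rewrite /harmonic /=; field.
- exact: cvg_cst.
- by rewrite -[X in _ --> X](mulr0 (r * q * y ^+ 2)); apply: cvgM; [exact: cvg_cst|exact: cvg_harmonic].
Unshelve. all: by end_near. Qed.

(** On [u <= V] the first stage restarts at time [u]. On [V < u] with the sum beyond [u], the second
    stage is under way and restarts at [u]; since [G 0 = 1], this second event has probability
    [G u - exp (- r u)]. *)
Let G_eq : hypo_eq r q G.
Proof.
move=> u h u0 h0.
have mVle : measurable [set w | u <= V w] by exact: measurable_le_set.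
have J21 : J2 `&` J1 = set0 by rewrite setIC.
have shift y : pr P ([set w | y + u < V w + W w] `&` [set w | u <= V w]) = expR (- r * u) * G y.
  rewrite -(exp_memoryless_shift mF indF V_gt V_ge mV J12 y u0 mW).
  by congr (pr P _); apply/seteqP; split => w /= [].
have := prDI P (mG (u + h)) mVle; rewrite {1}(addrC u h) shift.
have := prDI P (mG u) mVle; rewrite -{1}(add0r u) shift G0 mulr1.
rewrite -![pr P [set w | _ < _]]/(G _).
have eD x : [set w | x < V w + W w] `\` [set w | u <= V w] =
    [set w | V w < u /\ x < V w + W w].
  apply/seteqP; split => w /=; first by move=> [? /negP]; rewrite -ltNge.
  by move=> [? ?]; split => //; apply/negP; rewrite -ltNge.
rewrite !eD.
suff : pr P [set w | V w < u /\ u + h < V w + W w] =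
    expR (- q * h) * pr P [set w | V w < u /\ u < V w + W w] by move=> -> e1 <-; rewrite -e1; ring.
have me x : measurable [set w | V w < u /\ x < V w + W w].
  by rewrite -eD; exact: measurableD.
apply: EFin_inj; rewrite EFinM -!prE//.
pose Z (x : R) : set (R * R) := [set p | p.1 < u /\ x < p.1 + p.2].
have mZ x : measurable (Z x).
  apply: (measurableI [set p : R * R | p.1 < u] [set p : R * R | x < p.1 + p.2]).
    exact: measurable_lt_set.
  by apply: measurable_lt_set => //; exact: measurable_funD.
rewrite [LHS](indep_pair mF indF J12 mV mW (mZ (u + h))).
rewrite [X in (_ * X)%E](indep_pair mF indF J12 mV mW (mZ u)).
rewrite -ge0_integralZl_EFin ?expR_ge0//; last first.
  exact: (measurable_indep_slice P mF mV mW (mZ u)).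
apply: eq_integral => w _.
have [Vu|uV] := ltP (V w) u; last first.
  have e x : [set w' | Z x (V w, W w')] = set0.
    by apply/seteqP; split => // w'; rewrite /Z /= ltNge uV => -[].
  by rewrite !e measure0 mule0.
have e x : [set w' | Z x (V w, W w')] = [set w' | x - V w < W w'].
  by apply/seteqP; split => w'; rewrite /Z /= Vu; [move=> [_]; lra|move=> ?; split => //; lra].
rewrite !e !prE; [|exact: measurable_lt_set..].
rewrite !W_gt -EFinM -expRD; congr (expR _)%:E.
by rewrite !(max_idPr _); [ring|lra|lra].
Qed.

Lemma pr_exp_sum y : 0 <= y -> pr P [set w | y < V w + W w] = hypo r q y.
Proof.
apply: (hypo_eq_unique r0 q0 G_eq (@hypo_hypo_eq _ r q) G_flat (@hypo_flat_start _ r q)).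
by rewrite hypo0; exact: G0.
Qed.

(** A sum above [y] has a stage above [y / 2]. Reading [hypo] as a probability, here and in the next
    lemmas, spares the distinction between equal and different rates. *)
Lemma hypo_decay y : 0 <= y ->
  hypo r q y <= expR (- r * (y / 2)) + expR (- q * (y / 2)).
Proof.
move=> y0; rewrite -pr_exp_sum//.
have mv := sigma_of_measurable mF (sV (y / 2)); have mw := sigma_of_measurable mF (sW (y / 2)).
have y20 : 0 <= y / 2 by lra.
have := V_gt (y / 2); have := W_gt (y / 2); rewrite (max_idPr y20) => <- <-.
apply: (@le_trans _ _ (pr P ([set w | y / 2 < V w] `|` [set w | y / 2 < W w]))).
  apply: le_pr => //; first exact: measurableU.
  move=> w /= ys; have [h|h] := ltP (y / 2) (V w); [by left|right; rewrite /=; lra].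
have := prI_inclusion_exclusion P mv mw.
by have := pr_ge0 P ([set w | y / 2 < V w] `&` [set w | y / 2 < W w]); lra.
Qed.

Lemma hypo_ge0 y : 0 <= y -> 0 <= hypo r q y.
Proof. by move=> y0; rewrite -pr_exp_sum//; exact: pr_ge0. Qed.

Lemma hypo_homo y z : 0 <= y -> y <= z -> hypo r q z <= hypo r q y.
Proof.
move=> y0 yz; rewrite -!pr_exp_sum ?(le_trans y0)//; apply: le_pr => // w.
exact: le_lt_trans.
Qed.

Lemma hypo_le1 y : 0 <= y -> hypo r q y <= 1.
Proof. by move=> y0; rewrite -pr_exp_sum//; exact: pr_le1. Qed.

End exponential_sum.

(** * Deliveries in the network *)

Section residual_time.
Context (R : realType) (n : nat) (T : Type) (X S : 'I_n -> nat -> T -> R).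
Implicit Types (j : 'I_n) (k M : nat) (w : T) (t : R).

(* From the arrival of update [k] at server [j], the time until the first
   delivery if it happens by update [k + M]; after [M] preemptions the recursion
   stops at the current service time, which makes the law exactly exponential. *)
Fixpoint resid j M k w : R :=
  if M is M'.+1 then
    if S j k w < X j k.+1 w then S j k w
    else Num.max 0 (X j k.+1 w) + resid j M' k.+1 w
  else S j k w.

Lemma arrivalS j k w : arrival X j k.+1 w = arrival X j k w + X j k.+1 w.
Proof. by rewrite /arrival big_ord_recr. Qed.

Lemma arrivalE j k w : arrival X j k w = \sum_(i < k) X j i w + X j k w.
Proof. by rewrite /arrival big_ord_recr. Qed.

Lemma arrival_homo j w : (forall i, 0 <= X j i w) ->
  {homo (fun k => arrival X j k w) : k l / (k <= l)%N >-> k <= l}.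
Proof.
move=> X0; apply: homo_leq => [//|? ? ?|k]; first exact: le_trans.
by rewrite arrivalS lerDl.
Qed.

Lemma le_arrival j k i w : (forall i, 0 <= X j i w) -> (i <= k)%N ->
  X j i w <= arrival X j k w.
Proof.
move=> X0 ik; apply: (le_trans _ (arrival_homo X0 ik)).
by rewrite arrivalE lerDr sumr_ge0.
Qed.

(** This is the pathwise meaning of [resid]. The cut after [M] preemptions is invisible at time [t],
    because every delivery from update [k + M] on comes after the arrival of that update, hence
    after [t]. *)
Lemma lt_resid j t w M k : (forall i, 0 <= X j i w) -> (forall i, 0 <= S j i w) ->
  t < arrival X j (k + M) w ->
  t < arrival X j k w + resid j M k w <->
  (forall i, (k <= i)%N -> delivered X S j i w -> t < arrival X j i w + S j i w).
Proof.
move=> X0 S0; elim: M k => [|M ih] k; rewrite ?addn0 ?addnS => tk.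
  split=> [_ i ki _|_ /=]; last by rewrite (lt_le_trans tk)// lerDl.
  by rewrite (lt_le_trans tk)// (le_trans (arrival_homo X0 ki))// lerDl.
rewrite /=; case: (ltP (S j k w)) => SX.
  split=> [h i|h]; last exact: (h k (leqnn k) SX).
  rewrite leq_eqVlt => /predU1P[<-//|ki _].
  rewrite (lt_le_trans h)// (@le_trans _ _ (arrival X j k.+1 w))//.
    by rewrite arrivalS lerD2l ltW.
  by rewrite (le_trans (arrival_homo X0 ki))// lerDl.
rewrite (max_idPr (X0 _)) addrA -arrivalS.
have -> := ih k.+1; last by rewrite addSn.
split=> h i.
  rewrite leq_eqVlt => /predU1P[<-|ki]; last exact: h.
  by rewrite /delivered ltNge SX.
by move=> ki; apply: h; exact: ltnW.
Qed.

(** Up to ties, the event that the age due to this server alone exceeds [t - s]. Unlike the supremum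
    defining the age, it is a countable intersection of conditions, and the network version is an
    intersection over independent servers. *)
Definition server_stale j s t : set T :=
  [set w | forall k, ~ [/\ s <= arrival X j k w, delivered X S j k w
                        & arrival X j k w + S j k w <= t]].

Definition stale s t : set T := [set w | forall j, server_stale j s t w].

End residual_time.

(** * Probabilities of staleness for one server and for the network *)

Section network.
Context d (T : measurableType d) (R : realType) (P : probability T R) (n : nat)
  (lam mu : R) (X S : 'I_n -> nat -> {RV P >-> R}).
Hypotheses (lam0 : 0 < lam) (mu0 : 0 < mu).

Let X' j k : T -> R := X j k.
Let S' j k : T -> R := S j k.
Let I := (bool * 'I_n * nat)%type.
Let F := all_rvs X' S'.

Hypothesis indF : mutually_independent P F.
Hypothesis X_exp : forall j k, exp_distributed lam (X j k).
Hypothesis S_exp : forall j k, exp_distributed mu (S j k).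

Lemma measurable_all_rvs i : measurable_fun setT (F i).
Proof. by rewrite /F /all_rvs; case: ifP => _; exact: measurable_funP. Qed.
Let mF := measurable_all_rvs.

(** The variables of server [j] split into [past], [future] and the single index [Xidx j k], the
    interarrival time that straddles the observation time and is cut there by memorylessness. The
    [k]-th service starts at the [k]-th arrival, so it belongs to [future]. *)
Definition past j k : set I := [set i | i.1.2 = j /\ (i.2 < k)%N].
Definition future j k : set I :=
  [set i | i.1.2 = j /\ (if i.1.1 then (k <= i.2)%N else (k < i.2)%N)].
Definition server j : set I := [set i | i.1.2 = j].

Definition Xidx j k : I := (false, j, k).
Definition Sidx j k : I := (true, j, k).

Lemma measurable_X (J : set I) j k : J (Xidx j k) ->
  measurable_fun setT (X j k : Tsig F J -> R).
Proof. exact: (@measurable_Tsig _ _ _ _ F J (Xidx j k)). Qed.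

Lemma measurable_S (J : set I) j k : J (Sidx j k) ->
  measurable_fun setT (S j k : Tsig F J -> R).
Proof. exact: (@measurable_Tsig _ _ _ _ F J (Sidx j k)). Qed.

Lemma measurable_arrival (J : set I) j k : (forall i, (i <= k)%N -> J (Xidx j i)) ->
  measurable_fun setT (arrival X' j k : Tsig F J -> R).
Proof.
move=> h; rewrite /arrival; apply: measurable_sum => i.
by apply: measurable_X; apply: h; rewrite -ltnS.
Qed.

Lemma measurable_resid j M k :
  measurable_fun setT (resid X' S' j M k : Tsig F (future j k) -> R).
Proof.
suff H (J : set I) : future j k `<=` J ->
    measurable_fun setT (resid X' S' j M k : Tsig F J -> R) by exact: H.
elim: M k => [|M ih] k kJ /=; first by apply: measurable_S; apply: kJ; split => /=.
have mS : measurable_fun setT (S' j k : Tsig F J -> R).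
  by apply: measurable_S; apply: kJ; split => /=.
have mX : measurable_fun setT (X' j k.+1 : Tsig F J -> R).
  by apply: measurable_X; apply: kJ; split => /=.
apply: measurable_fun_ifT => //; first exact: measurable_fun_ltr.
apply: measurable_funD; first exact: measurable_maxr.
apply: ih => i [ij h]; apply: kJ; split => //.
by case: (i.1.1) h => [/ltnW|/ltnW].
Qed.

Lemma disj_sets (J1 J2 : set I) : (forall i, J1 i -> J2 i -> False) -> J1 `&` J2 = set0.
Proof. by move=> h; apply/seteqP; split => // i [/h]. Qed.

(** A preemption replaces an unfinished service by a fresh one of the same rate, so it does not
    affect the law of the remaining time. *)
Lemma resid_tail j M k : exp_tail P mu (resid X' S' j M k).
Proof.
elim: M k => [|M ih] k /=; first exact: exp_distributed_tail.
apply: (exp_tail_preempt (J1 := [set Xidx j k.+1]) (J2 := [set Sidx j k])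
  (J3 := future j k.+1) mF indF).
- exact: exp_distributed_tail.
- by move=> x; exact: exp_distributed_tail_ge.
- exact: measurable_S.
- by apply: disj_sets => i /= ->.
- by apply: disj_sets => i /= -> [] /=; rewrite ltnn.
- by apply: disj_sets => i /= -> [] /=; rewrite ltnn.
- exact: measurable_X.
- exact: measurable_resid.
- exact: ih.
Qed.

Let sstale := server_stale X' S'.
Let stale := stale X' S'.

Definition first_after j s k : set T :=
  [set w | (forall i, (i < k)%N -> arrival X' j i w < s) /\ s <= arrival X' j k w].

Definition nonneg_times : set T := [set w | forall j k, 0 <= X' j k w /\ 0 <= S' j k w].

Definition before j s k : set T := [set w | forall i, (i < k)%N -> arrival X' j i w < s].

Lemma sigma_before j s k : sigma_of F (past j k) (before j s k).
Proof.
have -> : before j s k = \bigcap_(i in [set i | (i < k)%N]) [set w | arrival X' j i w < s].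
  by apply/seteqP; split.
apply: (@bigcap_measurableType _ (Tsig F (past j k))) => i /= ik.
apply: (@measurable_lt_set _ _ (Tsig F (past j k))) => //.
by apply: measurable_arrival => l li; split => //=; exact: leq_ltn_trans ik.
Qed.

Lemma measurable_first_after j s k : measurable (first_after j s k).
Proof.
apply: (measurableI (before j s k) [set w | s <= arrival X' j k w]).
  exact: (sigma_of_measurable mF (@sigma_before j s k)).
apply: measurable_le_set => //.
by apply: (Tsig_measurable mF (J := setT)); exact: measurable_arrival.
Qed.

Lemma sigma_server_stale j s t : sigma_of F (server j) (sstale j s t).
Proof.
have mA k : measurable_fun setT (arrival X' j k : Tsig F (server j) -> R).
  exact: measurable_arrival.
have -> : sstale j s t = \bigcap_k ~` ([set w | s <= arrival X' j k w] `&`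
    [set w | S' j k w < X' j k.+1 w] `&` [set w | arrival X' j k w + S' j k w <= t]).
  apply/seteqP; split => w h k; first by move=> _ [[? ?] ?]; apply: (h k).
  by move=> [? ? ?]; apply: (h k).
apply: (@bigcapT_measurable _ (Tsig F (server j))) => k; apply: measurableC.
have mX : measurable_fun setT (X' j k.+1 : Tsig F (server j) -> R).
  exact: measurable_X.
have mS : measurable_fun setT (S' j k : Tsig F (server j) -> R).
  exact: measurable_S.
apply: measurableI; first apply: measurableI.
- exact: (@measurable_le_set _ _ (Tsig F (server j))).
- exact: (@measurable_lt_set _ _ (Tsig F (server j))).
- apply: (@measurable_le_set _ _ (Tsig F (server j))) => //.
  exact: measurable_funD.
Qed.

Lemma measurable_server_stale j s t : measurable (sstale j s t).
Proof. exact: (sigma_of_measurable mF (@sigma_server_stale j s t)). Qed.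

Lemma measurable_nonneg_times : measurable nonneg_times.
Proof.
have -> : nonneg_times = \bigcap_k \bigcap_(j in [set: 'I_n])
    ([set w | 0 <= X' j k w] `&` [set w | 0 <= S' j k w]).
  by apply/seteqP; split => w h; [move=> k _ j _; exact: h|move=> j k; exact: h].
apply: bigcapT_measurable => k; apply: fin_bigcap_measurable => [|j _].
  exact: finite_finset.
by apply: measurableI; apply: measurable_le_set => //; exact: measurable_funP.
Qed.

Lemma all_rvs_ge0 i : P [set w | F i w < 0] = 0%E.
Proof.
have h (r : R) (Y : {RV P >-> R}) : 0 < r -> exp_distributed r Y -> P [set w | Y w < 0] = 0%E.
  move=> r0 hY.
  have m0 : measurable [set w | 0 <= Y w] by apply: measurable_le_set => //; exact: measurable_funP.
  have m1 : measurable [set w | Y w < 0] by apply: measurable_lt_set => //; exact: measurable_funP.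
  have := prDI P measurableT m0; rewrite setTI setTD prT.
  rewrite (exp_distributed_tail_ge _ r0 hY) maxxx mulr0 expR0 prE//.
  rewrite (_ : ~` _ = [set w | Y w < 0]); first by move=> e; congr (_%:E); lra.
  by apply/seteqP; split => w /=; [move/negP; rewrite -ltNge|move=> ?; apply/negP; rewrite -ltNge].
rewrite /F /all_rvs; case: ifP => _; [exact: (h mu)|exact: (h lam)].
Qed.

Lemma probability_nonneg_times : P nonneg_times = 1%E.
Proof.
(* The index type is countable; enumerating it through [unpickle] reduces the claim to a countable
   union of null sets. *)
have h : {ae P, forall w, forall m, if (unpickle m : option I) is Some i then 0 <= F i w else true}.
  apply/ae_foralln => m; case: (unpickle m) => [i|]; last exact: aeW.
  exists [set w | F i w < 0]; split; last by move=> w /= /negP; rewrite -ltNge.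
    by apply: measurable_lt_set => //; exact: mF.
  exact: all_rvs_ge0.
have n0 : P.-negligible (~` nonneg_times).
  apply: negligibleS h => w /=; apply: contra_not => h j k.
  have := h (pickle (Xidx j k)); have := h (pickle (Sidx j k)).
  by rewrite !pickleK.
have mN := measurable_nonneg_times.
have := prDI P measurableT mN; rewrite setTI setTD prT prE//.
rewrite [in X in _ + X]/pr measure_negligible//=; last exact: measurableC.
by rewrite addr0 => ->.
Qed.

(** Given the past, the wait from [s] to the first arrival is the overshoot of [X j k] over the time
    already elapsed since the previous arrival, hence again exponential of rate [lam]; the residual
    service time adds an independent exponential of rate [mu]. *)
Lemma pr_resid j M k H s t : sigma_of F (past j k) H ->
  0 < s -> s <= t ->
  pr P (H `&` first_after j s k `&`
        [set w | t < arrival X' j k w + resid X' S' j M k w]) =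
  pr P (H `&` first_after j s k) * hypo mu lam (t - s).
Proof.
move=> sH s0 st; pose A := H `&` before j s k `&` [set w | \sum_(i < k) X' j i w < s].
have mprev : measurable_fun setT ((fun w => \sum_(i < k) X' j i w) : Tsig F (past j k) -> R).
  by apply: measurable_sum => i; apply: measurable_X; split => /=.
have sA : sigma_of F (past j k) A.
  apply: (@measurableI _ (Tsig F (past j k))).
    by apply: (@measurableI _ (Tsig F (past j k))) => //; exact: sigma_before.
  exact: (@measurable_lt_set _ _ (Tsig F (past j k))).
(* On [A], [Q] is the time from the previous arrival (from 0 if [k = 0]) to [s]; elsewhere it is -1.
   Thus [0 < Q] and [Q <= X j k] together describe [H] intersected with [first_after j s k]. *)
pose Q w := \1_A w * (s - \sum_(i < k) X' j i w + 1) - 1.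
have mQ : measurable_fun setT (Q : Tsig F (past j k) -> R).
  apply: measurable_funB => //; apply: measurable_funM.
    exact: (@measurable_indic _ (Tsig F (past j k))).
  by apply: measurable_funD => //; exact: measurable_funB.
have QA w : A w -> Q w = s - \sum_(i < k) X' j i w.
  by move=> Aw; rewrite /Q indicE mem_set// mul1r addrK.
have QN w : ~ A w -> Q w = -1.
  by move=> Aw; rewrite /Q indicE memNset// mul0r sub0r.
have J12 : past j k `&` [set Xidx j k] = set0.
  by apply: disj_sets => i [_ ik] /= e; move: ik; rewrite e /= ltnn.
have J13 : past j k `&` future j k = set0.
  apply: disj_sets => i [_ ik] [_]; case: ifP => _; first by rewrite leqNgt ik.
  by move=> /ltnW; rewrite leqNgt ik.
have J23 : [set Xidx j k] `&` future j k = set0.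
  by apply: disj_sets => i /= -> [_] /=; rewrite ltnn.
have mX : measurable_fun setT (X' j k : Tsig F [set Xidx j k] -> R) by exact: measurable_X.
have X_gt : exp_tail P lam (X' j k) by exact: exp_distributed_tail.
have X_ge x : pr P [set w | x <= X' j k w] = expR (- lam * Num.max 0 x).
  exact: exp_distributed_tail_ge.
have := exp_memoryless mF indF X_gt X_ge mX J12 J13 J23 (t - s) mQ (@measurable_resid j M k).
rewrite (pr_exp_sum mF indF lam0 mu0 X_gt X_ge (@resid_tail j M k) mX (@measurable_resid j M k) J23);
  last by rewrite subr_ge0.
rewrite hypoC.
have eQ w : (0 < Q w /\ Q w <= X' j k w) <-> (H w /\ first_after j s k w).
  rewrite /first_after /= arrivalE; have [Aw|nA] := pselect (A w).
    rewrite QA//; case: Aw => -[Hw bw] /= lw; split => [[_ h]|[_ [_ h]]].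
      by do 2 split => //; lra.
    by split; lra.
  rewrite QN//; split => [[]|[Hw [bw h]]]; first by lra.
  case: nA; split => //=; case: (k) bw => [_|m bw]; first by rewrite big_ord0.
  exact: (bw m).
have {}eQ2 w : H w -> first_after j s k w ->
    (t - s + Q w < X' j k w + resid X' S' j M k w) =
    (t < arrival X' j k w + resid X' S' j M k w).
  move=> Hw fw; have [Q0 _] := (eQ w).2 (conj Hw fw).
  have [Aw|nA] := pselect (A w); last by move: Q0; rewrite QN//; lra.
  by rewrite QA// arrivalE; apply/idP/idP; lra.
have -> : [set w | 0 < Q w /\ Q w <= X' j k w] = H `&` first_after j s k.
  by apply/seteqP; split => w /eQ.
move=> <-; congr (pr P _); apply/seteqP; split => w /=.
  by move=> [[Hw fw] h]; have [? ?] := (eQ w).2 (conj Hw fw); split => //; rewrite eQ2.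
by move=> [Q0 Qw h]; have [Hw fw] := (eQ w).1 (conj Q0 Qw); split => //; rewrite -eQ2.
Qed.

Lemma measurable_arrivalT j k : measurable_fun setT (arrival X' j k).
Proof. by apply: (Tsig_measurable mF (J := setT)); exact: measurable_arrival. Qed.

(** An arrival time bounds each of its nonnegative interarrival times, so all [m + 1] of them are at
    most [t]. This crude geometric bound is enough to discard late indices. *)
Lemma pr_arrival_le j m t : 0 <= t ->
  pr P [set w | arrival X' j m w <= t] <= (1 - expR (- lam * t)) ^+ m.+1.
Proof.
move=> t0; pose s := [seq Xidx j i | i <- index_iota 0 m.+1].
have us : uniq s by rewrite map_inj_uniq ?iota_uniq// => i i' [].
have mI (i : I) : measurable (F i @^-1` `]-oo, t]%classic).
  by rewrite -[X in measurable X]setTI; exact: mF.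
have := indF us (B := fun=> `]-oo, t]%classic) (fun=> measurable_itv _).
have -> : (\prod_(i <- s) P (F i @^-1` `]-oo, t]%classic))%E = ((1 - expR (- lam * t)) ^+ m.+1)%:E.
  rewrite big_map (eq_bigr (fun=> (1 - expR (- lam * t))%:E)).
    by rewrite prodEFin prodr_const_nat subn0.
  move=> i _; rewrite prE//; congr (_%:E).
  have mgt : measurable [set w | t < X' j i w].
    by apply: measurable_lt_set => //; exact: measurable_funP.
  have := prDI P measurableT (mI (Xidx j i)); rewrite setTI setTD prT.
  have := exp_distributed_tail lam0 (X_exp j i) t; rewrite (max_idPr t0).
  rewrite (_ : ~` _ = [set w | t < X' j i w]); first by move=> ->; lra.
  by apply/seteqP; split => w /=; rewrite in_itv/= /F /all_rvs /=;
    [move/negP; rewrite -ltNge|move=> ?; apply/negP; rewrite -ltNge].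
have mcap : measurable (\bigcap_(i in [set` s]) F i @^-1` `]-oo, t]%classic).
  by apply: fin_bigcap_measurable => //; exact: finite_seq.
rewrite prE// => e; rewrite -(EFin_inj e).
have mA : measurable [set w | arrival X' j m w <= t].
  by apply: measurable_le_set => //; exact: measurable_arrivalT.
have mN := measurable_nonneg_times.
have -> : pr P [set w | arrival X' j m w <= t] =
    pr P ([set w | arrival X' j m w <= t] `&` nonneg_times).
  apply: (eq_pr_on mN) => //; [exact: measurableI|exact: probability_nonneg_times|].
  by move=> w Nw; split => [|[]].
apply: le_pr => //; first exact: measurableI.
move=> w [/= At Nw] i /mapP[l]; rewrite mem_index_iota /= => lm ->.
rewrite in_itv/= /F /all_rvs /=; apply: le_trans At.
by apply: le_arrival => // l'; have [] := Nw j l'.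
Qed.

Lemma pr_arrival_le0 j k t : 0 <= t ->
  pr P [set w | arrival X' j (k + m) w <= t] @[m --> \oo] --> 0.
Proof.
move=> t0; have a1 : `|1 - expR (- lam * t)| < 1.
  have := expR_gt0 (- lam * t).
  have : expR (- lam * t) <= 1 by rewrite -expR0 ler_expR mulNr oppr_le0 mulr_ge0// ltW.
  by move=> h1 h2; rewrite ger0_norm; lra.
have := cvg_expr a1; rewrite -(cvg_shiftn (k + 1)) => h.
apply: (squeeze_cvgr _ (cvg_cst 0) h); near=> m.
rewrite pr_ge0 /= addnC (le_trans (pr_arrival_le _ _ t0))//.
by rewrite addnA addn1 addnC.
Unshelve. all: by end_near. Qed.

Lemma pr_first_afterE j s (A : set T) K : measurable A ->
  pr P A = \sum_(k < K) pr P (A `&` first_after j s k) + pr P (A `&` before j s K).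
Proof.
move=> mA.
have mb k : measurable (before j s k).
  exact: (sigma_of_measurable mF (@sigma_before j s k)).
elim: K => [|K ->].
  by rewrite big_ord0 add0r; congr pr; apply/seteqP; split => w; [|case].
rewrite big_ord_recr/= -addrA; congr (_ + _).
rewrite -(prDI P (measurableI _ _ mA (mb K)) (measurable_first_after j s K)).
congr (pr P _ + pr P _); apply/seteqP; split => w /=.
- by move=> [[Aw _] fw].
- by move=> [Aw [bw h]].
- move=> [[Aw bw] h]; split => // i; rewrite ltnS leq_eqVlt => /predU1P[->|/bw//].
  by rewrite ltNge; apply/negP => sa; apply: h; split.
- move=> [Aw bw]; split; first by split => // i ik; apply: bw; exact: ltnW.
  by move=> [_]; rewrite leNgt bw.
Qed.

(* [H] depends only on what happened before the first arrival after [s]. *)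
Definition adapted j s (H : set T) := forall k, exists2 Hk, sigma_of F (past j k) Hk &
  forall w, nonneg_times w -> first_after j s k w -> (H w <-> Hk w).

(** Neither side involves [M]. The staleness event and the truncated event of [pr_resid] differ only
    if update [k + M] arrives by time [t], and this probability tends to 0 as [M] grows. *)
Lemma pr_server_stale_first_after j k s t H : measurable H -> adapted j s H -> 0 < s -> s <= t ->
  pr P (H `&` sstale j s t `&` first_after j s k) =
  pr P (H `&` first_after j s k) * hypo mu lam (t - s).
Proof.
move=> mH /(_ k) [Hk sHk HHk] s0 st.
have mHk := sigma_of_measurable mF sHk.
have mN := measurable_nonneg_times.
have mfa := measurable_first_after j s k.
have mfr := measurable_server_stale j s t.
have -> : pr P (H `&` first_after j s k) = pr P (Hk `&` first_after j s k).
  apply: (eq_pr_on mN); [exact: measurableI|exact: measurableI|exact: probability_nonneg_times|].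
  by move=> w Nw; split=> -[Hw fw]; split => //; apply/(HHk w Nw fw).
apply/eqP; rewrite -subr_eq0 -normr_eq0; apply/eqP/le_anti; rewrite normr_ge0 andbT.
have t0 : 0 <= t by lra.
have lim := @pr_arrival_le0 j k t t0.
rewrite -(cvg_lim _ lim)//; apply: limr_ge; first by apply/cvg_ex; exists 0.
near=> M.
rewrite -(pr_resid (k := k) M sHk s0 st).
apply: (pr_dist_le mN).
- by apply: measurableI => //; exact: measurableI.
- apply: measurableI; first exact: measurableI.
  apply: measurable_lt_set => //; apply: measurable_funD; first exact: measurable_arrivalT.
  exact: (Tsig_measurable mF (@measurable_resid j M k)).
- by apply: measurable_le_set => //; exact: measurable_arrivalT.
- exact: probability_nonneg_times.
move=> w Nw /= /negP; rewrite -ltNge => tM.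
have X0 i : 0 <= X' j i w by have [] := Nw j i.
have S0 i : 0 <= S' j i w by have [] := Nw j i.
have key := @lt_resid _ _ _ X' S' j t w M k X0 S0 tM.
split=> [[[Hw fw] aw]|[[Hw aw] lw]].
  split; first by split => //; apply/(HHk w Nw aw).
  apply/key => i ki di; rewrite ltNge; apply/negP => h; apply: (fw i); split => //.
  by apply: le_trans (arrival_homo X0 ki); case: aw.
split => //; split; first exact/(HHk w Nw aw).
move=> i [si di]; have [ki|ik] := leqP k i.
  by have /key/(_ i ki di) := lw; rewrite ltNge => /negP.
by case: aw => /(_ i ik); rewrite ltNge si.
Unshelve. all: by end_near. Qed.

Section hypo_of_server.
Variable j : 'I_n.

Let S_gt : exp_tail P mu (S' j 0). Proof. exact: exp_distributed_tail. Qed.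
Let S_ge x : pr P [set w | x <= S' j 0 w] = expR (- mu * Num.max 0 x).
Proof. exact: exp_distributed_tail_ge. Qed.
Let X_gt : exp_tail P lam (X' j 0). Proof. exact: exp_distributed_tail. Qed.
Let mS : measurable_fun setT (S' j 0 : Tsig F [set Sidx j 0] -> R).
Proof. exact: measurable_S. Qed.
Let mX : measurable_fun setT (X' j 0 : Tsig F [set Xidx j 0] -> R).
Proof. exact: measurable_X. Qed.
Let disj : [set Sidx j 0] `&` [set Xidx j 0] = set0.
Proof. by apply: disj_sets => i ->. Qed.

(** These bounds come from the tail of [S' j 0 + X' j 0], so they require a server; the theorem
    supplies [Ordinal n0]. *)
Lemma hypo_network_ge0 y : 0 <= y -> 0 <= hypo mu lam y.
Proof. exact: (hypo_ge0 mF indF mu0 lam0 S_gt S_ge X_gt mS mX disj). Qed.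

Lemma hypo_network_le1 y : 0 <= y -> hypo mu lam y <= 1.
Proof. exact: (hypo_le1 mF indF mu0 lam0 S_gt S_ge X_gt mS mX disj). Qed.

Lemma hypo_network_homo y z : 0 <= y -> y <= z -> hypo mu lam z <= hypo mu lam y.
Proof. exact: (hypo_homo mF indF mu0 lam0 S_gt S_ge X_gt mS mX disj). Qed.

Lemma hypo_network_decay y : 0 <= y ->
  hypo mu lam y <= expR (- mu * (y / 2)) + expR (- lam * (y / 2)).
Proof. exact: (hypo_decay mF indF mu0 lam0 S_gt S_ge X_gt mS mX disj). Qed.

End hypo_of_server.

(** The factor [hypo mu lam (t - s)] is the same for every index of the first arrival from [s] on,
    so it comes out of the sum over that index. What remains after [K + 1] terms has at least
    [K + 1] arrivals before [s], and vanishes in the limit. *)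
Lemma pr_server_stale_adapted j s t H : measurable H -> adapted j s H -> 0 < s -> s <= t ->
  pr P (H `&` sstale j s t) = pr P H * hypo mu lam (t - s).
Proof.
move=> mH aH s0 st; set g := hypo _ _ _.
have mfr := measurable_server_stale j s t.
have mHf := measurableI _ _ mH mfr.
have mb K : measurable (before j s K).
  exact: (sigma_of_measurable mF (@sigma_before j s K)).
have g0 : 0 <= g <= 1.
  by rewrite (hypo_network_ge0 j) ?(hypo_network_le1 j) ?subr_ge0.
apply/eqP; rewrite -subr_eq0 -normr_eq0; apply/eqP/le_anti; rewrite normr_ge0 andbT.
have lim := @pr_arrival_le0 j 0 s (ltW s0).
rewrite -(cvg_lim _ lim)//; apply: limr_ge; first by apply/cvg_ex; exists 0.
near=> K; rewrite add0n.
have e1 := @pr_first_afterE j s _ K.+1 mHf.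
have e2 := @pr_first_afterE j s _ K.+1 mH.
have e3 : \sum_(k < K.+1) pr P (H `&` sstale j s t `&` first_after j s k) =
    (\sum_(k < K.+1) pr P (H `&` first_after j s k)) * g.
  by rewrite mulr_suml; apply: eq_bigr => k _; exact: pr_server_stale_first_after.
have le1 A : measurable A -> pr P (A `&` before j s K.+1) <= pr P [set w | arrival X' j K w <= s].
  move=> mA; apply: le_pr; first exact: measurableI.
    by apply: measurable_le_set => //; exact: measurable_arrivalT.
  by move=> w [_ /(_ K (ltnSn K))] /= /ltW.
have := le1 _ mH; have := le1 _ mHf.
have := pr_ge0 P (H `&` before j s K.+1).
have := pr_ge0 P (H `&` sstale j s t `&` before j s K.+1).
rewrite e1 e3 e2 ler_norml.
set a := pr P (_ `&` _ `&` _); set b := pr P (_ `&` _); set c := pr P _; set S0 := \sum_(_ < _) _.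
move=> a0 b0 ac bc.
have : 0 <= b * g <= b by case/andP: g0 => ? ?; rewrite mulr_ge0//= ler_piMr.
by rewrite mulrDl; lra.
Unshelve. all: by end_near. Qed.

Lemma adaptedT j s : adapted j s setT.
Proof.
by move=> k; exists setT => //; exact: (@measurableT _ (Tsig F (past j k))).
Qed.

Lemma pr_server_stale j s t : 0 < s -> s <= t -> pr P (sstale j s t) = hypo mu lam (t - s).
Proof.
move=> s0 st; have := pr_server_stale_adapted measurableT (@adaptedT j s) s0 st.
by rewrite setTI prT mul1r.
Qed.

Lemma adapted_server_stale j s s' t' : t' < s -> adapted j s (sstale j s' t').
Proof.
move=> ts k.
(* The delivery of update [k - 1] depends on [X j k], which is outside [past j k]. The guard
   [i.+1 < k] drops that condition for [i = k - 1]: it holds automatically, since the service ends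
   by [t' < s] while update [k] arrives at [s] or later. *)
exists (\bigcap_(i in [set i | (i < k)%N]) ~` ([set w | s' <= arrival X' j i w] `&`
   [set w | (i.+1 < k)%N -> S' j i w < X' j i.+1 w] `&`
   [set w | arrival X' j i w + S' j i w <= t'])).
  have mA i : (i < k)%N -> measurable_fun setT (arrival X' j i : Tsig F (past j k) -> R).
    by move=> ik; apply: measurable_arrival => l li; split => //=; exact: leq_ltn_trans ik.
  have mS i : (i < k)%N -> measurable_fun setT (S' j i : Tsig F (past j k) -> R).
    by move=> ik; apply: measurable_S; split.
  apply: (@bigcap_measurableType _ (Tsig F (past j k))) => i /= ik; apply: measurableC.
  apply: measurableI; first apply: measurableI.
  - by apply: (@measurable_le_set _ _ (Tsig F (past j k))) => //; exact: mA.
  - have [ik'|ki] := ltnP i.+1 k; last first.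
      rewrite (_ : mkset _ = setT); first exact: (@measurableT _ (Tsig F (past j k))).
      by apply/seteqP; split.
    rewrite (_ : mkset _ = [set w | S' j i w < X' j i.+1 w]); last first.
      by apply/seteqP; split => w /=; [exact|].
    by apply: (@measurable_lt_set _ _ (Tsig F (past j k))) => //; [exact: mS|apply: measurable_X; split].
  - apply: (@measurable_le_set _ _ (Tsig F (past j k))) => //.
    by apply: measurable_funD; [exact: mA|exact: mS].
move=> w Nw [bw sk].
have X0 i : 0 <= X' j i w by have [] := Nw j i.
have S0 i : 0 <= S' j i w by have [] := Nw j i.
split=> h i.
  move=> /= ik [[si di] ti]; apply: (h i); split => //; rewrite /delivered.
  move: ik; rewrite leq_eqVlt => /predU1P[e|]; last exact: di.
  by move: sk; rewrite -e arrivalS; lra.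
move=> [si di ti]; have [ik|ki] := ltnP i k.
  by apply: (h i ik); split => //; split.
by have := arrival_homo X0 ki; have := S0 i; lra.
Qed.

Lemma pr_server_stale2 j s t s' t' : 0 < s' -> s' <= t' -> t' < s -> s <= t ->
  pr P (sstale j s' t' `&` sstale j s t) = hypo mu lam (t' - s') * hypo mu lam (t - s).
Proof.
move=> s0 st ts st'; rewrite -(@pr_server_stale j)// pr_server_stale_adapted//.
- exact: measurable_server_stale.
- exact: adapted_server_stale.
- lra.
Qed.

Lemma measurable_stale s t : measurable (stale s t).
Proof.
rewrite (_ : stale s t = \bigcap_(j in [set: 'I_n]) sstale j s t); last first.
  by apply/seteqP; split => w h j; [move=> _; exact: h|exact: h].
by apply: fin_bigcap_measurable => [|j _]; [exact: finite_finset|exact: measurable_server_stale].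
Qed.

Lemma pr_servers (A : 'I_n -> set T) : (forall j, sigma_of F (server j) (A j)) ->
  pr P [set w | forall j, A j w] = \prod_j pr P (A j).
Proof.
move=> sA; rewrite -(@indep_groups _ _ _ P _ F mF indF _ server (index_enum 'I_n) A) //.
- congr pr; apply/seteqP; split => w h j; first by move=> _; exact: h.
  by apply: h; rewrite /= mem_index_enum.
- exact: index_enum_uniq.
- by move=> j j' jj'; apply: disj_sets => i; rewrite /server /= => ij ij'; rewrite -ij -ij' eqxx in jj'.
Qed.

Lemma pr_stale s t : 0 < s -> s <= t -> pr P (stale s t) = hypo mu lam (t - s) ^+ n.
Proof.
move=> s0 st; rewrite pr_servers; last by move=> j; exact: sigma_server_stale.
by rewrite (eq_bigr (fun=> hypo mu lam (t - s))) ?prodr_const ?card_ord// => j _; exact: pr_server_stale.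
Qed.

Lemma pr_stale2 s t s' t' : 0 < s' -> s' <= t' -> t' < s -> s <= t ->
  pr P (stale s' t' `&` stale s t) = pr P (stale s' t') * pr P (stale s t).
Proof.
move=> s0 st ts st'; rewrite !pr_stale//; last lra.
rewrite -exprMn (_ : _ `&` _ = [set w | forall j, (sstale j s' t' `&` sstale j s t) w]); last first.
  apply/seteqP; split => w; first by move=> [h1 h2] j; split; [exact: h1|exact: h2].
  by move=> h; split => j; have [h1 h2] := h j; [exact: h1|exact: h2].
rewrite pr_servers; last first.
  by move=> j; apply: (@measurableI _ (Tsig F (server j))); exact: sigma_server_stale.
rewrite (eq_bigr (fun=> hypo mu lam (t' - s') * hypo mu lam (t - s))) ?prodr_const ?card_ord//.
by move=> j _; exact: pr_server_stale2.
Qed.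

End network.

(** * Law of large numbers for weakly dependent events *)

Section mean.
Context d (T : measurableType d) (R : realType) (P : probability T R).
Implicit Types (f g : T -> R) (a b : R).

Definition has_mean f a :=
  P.-integrable setT (EFin \o f) /\ (\int[P]_w (f w)%:E)%E = a%:E.

Lemma has_mean_indic A : measurable A -> has_mean \1_A (pr P A).
Proof.
move=> mA; split; first exact: integrable_indic.
by rewrite integral_indic// setIT; exact: prE.
Qed.

Lemma has_mean_cst a : has_mean (fun=> a) a.
Proof.
split; first exact: finite_measure_integrable_cst.
by rewrite integral_cst// [X in (_ * X)%E]probability_setT mule1.
Qed.

Lemma has_meanD f g a b : has_mean f a -> has_mean g b ->
  has_mean (fun w => f w + g w) (a + b).
Proof.
move=> [i1 e1] [i2 e2]; split.
  rewrite (_ : _ \o _ = (EFin \o f) \+ (EFin \o g))%E//; exact: integrableD.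
by rewrite EFinD -e1 -e2 -integralD.
Qed.

Lemma has_meanZ f a b : has_mean f a -> has_mean (fun w => b * f w) (b * a).
Proof.
move=> [i1 e1]; split.
  rewrite (_ : _ \o _ = (fun w => b%:E * (EFin \o f) w))%E//; exact: integrableZl.
by rewrite EFinM -e1 -integralZl.
Qed.

Lemma has_mean_sum (J : Type) (s : seq J) (Q : pred J) (f : J -> T -> R) (a : J -> R) :
  (forall j, Q j -> has_mean (f j) (a j)) ->
  has_mean (fun w => \sum_(j <- s | Q j) f j w) (\sum_(j <- s | Q j) a j).
Proof.
move=> h; elim: s => [|j s ih].
  rewrite big_nil (_ : (fun w => _) = fun=> 0); first exact: has_mean_cst.
  by apply/funext => w; rewrite big_nil.
rewrite big_cons; have [Qj|nQ] := boolP (Q j).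
  rewrite (_ : (fun w => _) = (fun w => f j w + \sum_(j <- s | Q j) f j w)).
    by apply: has_meanD => //; exact: h.
  by apply/funext => w; rewrite big_cons Qj.
rewrite (_ : (fun w => _) = (fun w => \sum_(j <- s | Q j) f j w))//.
by apply/funext => w; rewrite big_cons (negbTE nQ).
Qed.

End mean.

Section geometric.
Context (R : realType) (tau : R).
Hypotheses (tau0 : 0 < tau) (tau1 : tau < 1).

Lemma sum_geom_le K : \sum_(l < K) tau ^+ l <= (1 - tau)^-1.
Proof.
have h : 0 < 1 - tau by rewrite subr_gt0.
have e : (1 - tau) * \sum_(l < K) tau ^+ l = 1 - tau ^+ K.
  elim: K => [|K ih]; first by rewrite big_ord0 expr0; ring.
  by rewrite big_ord_recr/= mulrDr ih exprS; ring.
rewrite -(ler_pM2l h) e divff ?gt_eqF// gerBl exprn_ge0// ltW//.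
Qed.

Lemma sum_geom_rev_le K : \sum_(l < K) tau ^+ (K - l) <= (1 - tau)^-1.
Proof.
apply: le_trans (sum_geom_le K.+1); rewrite (reindex_inj rev_ord_inj) /=.
rewrite big_ord_recl expr0; apply: (@le_trans _ _ (\sum_(i < K) tau ^+ i.+1)).
  by apply: ler_sum => i _; rewrite subKn.
by rewrite lerDr.
Qed.

(** With truncated subtraction the exponent is the distance between [k] and [k']. Passing from [K]
    to [K + 1] adds a row, a column and a corner, each at most [1 / (1 - tau)]; hence the 3. *)
Lemma sum_geom_dist_le K :
  \sum_(k < K) \sum_(k' < K) tau ^+ ((k - k') + (k' - k)) <= K%:R * (3 / (1 - tau)).
Proof.
have h : 0 < 1 - tau by rewrite subr_gt0.
elim: K => [|K ih]; first by rewrite big_ord0 mul0r.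
rewrite big_ord_recr/= -natr1 mulrDl mul1r.
under eq_bigr do rewrite big_ord_recr/=.
rewrite big_split/= -addrA lerD// big_ord_recr/= subnn addn0 expr0.
have e1 : \sum_(i < K) tau ^+ (i - K + (K - i)) = \sum_(i < K) tau ^+ (K - i).
  by apply: eq_bigr => i _; rewrite (eqP (ltnW (ltn_ord i)))// add0n.
have e2 : \sum_(i < K) tau ^+ (K - i + (i - K)) = \sum_(i < K) tau ^+ (K - i).
  by rewrite -e1; apply: eq_bigr => i _; rewrite addnC.
rewrite e1 e2; have := sum_geom_rev_le K.
have : 1 <= (1 - tau)^-1 by rewrite invf_ge1// gerBl ltW.
by rewrite !mulrDl mul1r; lra.
Qed.

End geometric.

(** * Variance bound and almost sure convergence along the squares *)

Section weak_dependence.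
Context d (T : measurableType d) (R : realType) (P : probability T R).
Context (Y : nat -> nat -> set T) (q : nat -> R) (C tau : R).
Hypotheses (tau0 : 0 < tau) (tau1 : tau < 1) (C0 : 0 <= C).
Hypothesis mY : forall k l, measurable (Y k l).
Hypothesis pY : forall k l, (l < k)%N -> pr P (Y k l) = q l.
Hypothesis pYY : forall k l k' l', (l < k)%N -> (l' < k')%N -> (l' + k < k')%N ->
  pr P (Y k l `&` Y k' l') = q l * q l'.
Hypothesis q_le : forall l, q l <= C * tau ^+ (4 * l).
Hypothesis q_ge0 : forall l, 0 <= q l.

Definition deviation K w :=
  \sum_(p : 'I_K * 'I_K | (p.2 < p.1)%N) (\1_(Y p.1 p.2) w - q p.2).

Definition covar (k l k' l' : nat) := pr P (Y k l `&` Y k' l') - q l * q l'.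

Lemma has_mean_deviation2 K : has_mean P (fun w => deviation K w ^+ 2)
  (\sum_(p : 'I_K * 'I_K | (p.2 < p.1)%N) \sum_(p' : 'I_K * 'I_K | (p'.2 < p'.1)%N)
     covar p.1 p.2 p'.1 p'.2).
Proof.
have -> : (fun w => deviation K w ^+ 2) = (fun w =>
  \sum_(p : 'I_K * 'I_K | (p.2 < p.1)%N) \sum_(p' : 'I_K * 'I_K | (p'.2 < p'.1)%N)
   (\1_(Y p.1 p.2) w - q p.2) * (\1_(Y p'.1 p'.2) w - q p'.2)).
  apply/funext => w; rewrite expr2 /deviation mulr_suml.
  by apply: eq_bigr => p _; rewrite mulr_sumr.
apply: has_mean_sum => -[k l] /= lk; apply: has_mean_sum => -[k' l'] /= lk'.
have -> : (fun w => (\1_(Y k l) w - q l) * (\1_(Y k' l') w - q l')) =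
  (fun w => \1_(Y k l `&` Y k' l') w + ((- q l') * \1_(Y k l) w +
            ((- q l) * \1_(Y k' l') w + q l * q l'))).
  by apply/funext => w; rewrite indicI /=; ring.
rewrite (_ : covar k l k' l' = pr P (Y k l `&` Y k' l') + ((- q l') * q l +
   ((- q l) * q l' + q l * q l'))); last by rewrite /covar; ring.
apply: has_meanD; first by apply: has_mean_indic; exact: measurableI.
apply: has_meanD; first by apply: has_meanZ; rewrite -(pY lk); exact: has_mean_indic.
apply: has_meanD; last exact: has_mean_cst.
by apply: has_meanZ; rewrite -(pY lk'); exact: has_mean_indic.
Qed.

Lemma tau_exp_le m p : (m <= p)%N -> tau ^+ p <= tau ^+ m.
Proof. by move=> mp; rewrite ler_wiXn2l// ltW. Qed.

(** A nonzero covariance forces the distance of [k] and [k'] to be at most the larger lag. The decay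
    [tau ^ (4 l)] at the larger lag then pays for the distance and for both lags, making the bound
    summable in all three. *)
Lemma covar_le k l k' l' : (l < k)%N -> (l' < k')%N ->
  covar k l k' l' <= C * (tau ^+ ((k - k') + (k' - k)) * (tau ^+ l * tau ^+ l')).
Proof.
move=> lk lk'; have r0 : 0 <= C * (tau ^+ ((k - k') + (k' - k)) * (tau ^+ l * tau ^+ l')).
  by rewrite mulr_ge0// !mulr_ge0// exprn_ge0// ltW.
have [h|h] := ltnP (l' + k) k'; first by rewrite /covar pYY// subrr.
have [h'|h'] := ltnP (l + k') k; first by rewrite /covar setIC pYY// mulrC subrr.
have qq : covar k l k' l' <= pr P (Y k l `&` Y k' l').
  by rewrite /covar gerBl mulr_ge0.
have mYY : measurable (Y k l `&` Y k' l') by exact: measurableI.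
apply: (le_trans qq).
have le1 : pr P (Y k l `&` Y k' l') <= C * tau ^+ (4 * l).
  by rewrite (le_trans _ (q_le l))// -(pY lk); apply: le_pr => //; exact: subIsetl.
have le2 : pr P (Y k l `&` Y k' l') <= C * tau ^+ (4 * l').
  by rewrite (le_trans _ (q_le l'))// -(pY lk'); apply: le_pr => //; exact: subIsetr.
rewrite -!exprD.
have [ll|ll] := leqP l l'; [apply: (le_trans le2)|apply: (le_trans le1)];
  apply: ler_wpM2l => //; apply: tau_exp_le; move: h h' ll; lia.
Qed.

Definition var_const := C * (3 / (1 - tau)) * ((1 - tau)^-1 ^+ 2).

Lemma covar_sum_le K :
  \sum_(p : 'I_K * 'I_K | (p.2 < p.1)%N) \sum_(p' : 'I_K * 'I_K | (p'.2 < p'.1)%N)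
     covar p.1 p.2 p'.1 p'.2 <= K%:R * var_const.
Proof.
pose b (k l k' l' : nat) : R := C * (tau ^+ ((k - k') + (k' - k)) * (tau ^+ l * tau ^+ l')).
have b0 k l k' l' : 0 <= b k l k' l'.
  by rewrite mulr_ge0// !mulr_ge0// exprn_ge0// ltW.
apply: (@le_trans _ _ (\sum_(p : 'I_K * 'I_K) \sum_(p' : 'I_K * 'I_K) b p.1 p.2 p'.1 p'.2)).
  rewrite big_mkcond; apply: ler_sum => -[k l] _ /=; case: ifPn => lk; last first.
    exact: sumr_ge0.
  rewrite big_mkcond; apply: ler_sum => -[k' l'] _ /=; case: ifPn => lk' //.
  exact: covar_le.
have -> : \sum_(p : 'I_K * 'I_K) \sum_(p' : 'I_K * 'I_K) b p.1 p.2 p'.1 p'.2 =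
   C * ((\sum_(k < K) \sum_(k' < K) tau ^+ ((k - k') + (k' - k))) *
        ((\sum_(l < K) tau ^+ l) * (\sum_(l < K) tau ^+ l))).
  rewrite -(pair_bigA _ (fun k l : 'I_K => \sum_(p' : 'I_K * 'I_K) b k l p'.1 p'.2)) /=.
  rewrite mulr_suml mulr_sumr; apply: eq_bigr => k _.
  rewrite [X in C * X](_ : _ = \sum_(l < K) (\sum_(k' < K) tau ^+ (k - k' + (k' - k))) *
    (tau ^+ l * \sum_(l < K) tau ^+ l)); last first.
    by rewrite -mulr_sumr -mulr_suml.
  rewrite mulr_sumr; apply: eq_bigr => l _.
  rewrite -(pair_bigA _ (fun k' l' : 'I_K => b k l k' l')) /=.
  rewrite mulr_suml mulr_sumr; apply: eq_bigr => k' _.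
  rewrite 2!mulr_sumr mulr_sumr; apply: eq_bigr => l' _.
  by rewrite /b; ring.
have h1 := sum_geom_dist_le tau0 tau1 K; have h2 := sum_geom_le tau0 tau1 K.
have h : 0 < 1 - tau by rewrite subr_gt0.
have s0 : 0 <= \sum_(l < K) tau ^+ l by apply: sumr_ge0 => l _; rewrite exprn_ge0// ltW.
have s1 : 0 <= \sum_(k < K) \sum_(k' < K) tau ^+ ((k - k') + (k' - k)).
  by do 2 (apply: sumr_ge0 => ? _); rewrite exprn_ge0// ltW.
rewrite /var_const [leRHS](_ : _ = C *
  ((K%:R * (3 / (1 - tau))) * ((1 - tau)^-1 * (1 - tau)^-1))); last by ring.
by apply: ler_wpM2l => //; apply: ler_pM => //; [exact: mulr_ge0|exact: ler_pM].
Qed.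

Lemma sum_inv_square_le m : \sum_(N < m) (N.+1%:R ^+ 2 : R)^-1 <= 2.
Proof.
case: m => [|m]; first by rewrite big_ord0.
suff : \sum_(N < m.+1) (N.+1%:R ^+ 2 : R)^-1 <= 2 - m.+1%:R^-1.
  by move=> /le_trans; apply; rewrite gerBl.
elim: m => [|m ih]; first by rewrite big_ord1 expr1n invr1; lra.
rewrite big_ord_recr/=.
have m0 : 0 < m.+1%:R :> R by [].
suff : (m.+2%:R ^+ 2 : R)^-1 <= m.+1%:R^-1 - m.+2%:R^-1.
  by move=> /(lerD ih)/le_trans; apply; rewrite addrA subrK.
rewrite -[m.+2%:R]natr1; set x : R := m.+1%:R in m0 *.
have -> : x^-1 - (x + 1)^-1 = (x * (x + 1))^-1 by field; rewrite !gt_eqF//; lra.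
by rewrite lef_pV2 ?posrE ?mulr_gt0 ?exprn_gt0//; rewrite ?expr2; [apply: ler_wpM2r|..]; lra.
Qed.

(** At [K = (N + 1) ^ 2] the squared normalized deviation has mean at most
    [var_const / (N + 1) ^ 2]. The series of these squares is therefore integrable, hence finite
    almost everywhere, and its terms tend to 0. *)
Lemma deviation_ae : {ae P, forall w,
  deviation (N.+1 ^ 2) w / (N.+1 ^ 2)%:R @[N --> \oo] --> 0}.
Proof.
pose f N w := (deviation (N.+1 ^ 2) w / (N.+1 ^ 2)%:R) ^+ 2.
pose m N := \sum_(p : 'I_(N.+1 ^ 2) * 'I_(N.+1 ^ 2) | (p.2 < p.1)%N)
  \sum_(p' : 'I_(N.+1 ^ 2) * 'I_(N.+1 ^ 2) | (p'.2 < p'.1)%N) covar p.1 p.2 p'.1 p'.2.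
have f0 N w : 0 <= f N w by exact: sqr_ge0.
have hf N : has_mean P (f N) (((N.+1 ^ 2)%:R ^+ 2)^-1 * m N).
  rewrite (_ : f N = fun w => ((N.+1 ^ 2)%:R ^+ 2)^-1 * deviation (N.+1 ^ 2) w ^+ 2).
    by apply: has_meanZ; exact: has_mean_deviation2.
  by apply/funext => w; rewrite /f exprMn exprVn mulrC.
have mf N : measurable_fun setT (EFin \o f N).
  by have [/measurable_int] := hf N.
have fle N : (\int[P]_w (f N w)%:E <= (var_const * (N.+1%:R ^+ 2)^-1)%:E)%E.
  have [_ ->] := hf N; rewrite lee_fin.
  have K0 : 0 < (N.+1 ^ 2)%:R :> R by rewrite ltr0n expn_gt0.
  rewrite mulrC ler_pdivrMr ?exprn_gt0//.
  rewrite (le_trans (covar_sum_le _))// natrX le_eqVlt; apply/orP; left; apply/eqP.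
  by field; rewrite gt_eqF.
have vc0 : 0 <= var_const.
  have h : 0 < 1 - tau by rewrite subr_gt0.
  by rewrite /var_const mulr_ge0 ?sqr_ge0// mulr_ge0// divr_ge0// ltW.
pose g w := (\sum_(N <oo) (f N w)%:E)%E.
have ig : P.-integrable setT g.
  have mg : measurable_fun setT g.
    apply: (@ge0_emeasurable_sum _ _ _ _ (fun N w => (f N w)%:E) xpredT).
      by move=> N w _ _; rewrite lee_fin.
    by move=> N _; exact: mf.
  apply/integrableP; split => //.
  rewrite (eq_integral g) => [|w _]; last first.
    by rewrite gee0_abs//; apply: nneseries_ge0 => N _ _; rewrite lee_fin.
  rewrite integral_nneseries//; last by move=> N w _; rewrite lee_fin.
  apply: (@le_lt_trans _ _ (var_const * 2)%:E); last by rewrite ltry.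
  apply: lime_le.
    by apply: is_cvg_nneseries => N _ _; apply: integral_ge0 => w _; rewrite lee_fin.
  near=> M; rewrite big_mkord.
  apply: (@le_trans _ _ (\sum_(N < M) (var_const * (N.+1%:R ^+ 2)^-1)%:E)%E).
    exact: lee_sum.
  rewrite sumEFin lee_fin -mulr_sumr; apply: ler_wpM2l => //.
  exact: sum_inv_square_le.
have := integrable_ae measurableT ig; apply: filterS => w /(_ I) gfin.
have cvs : cvgn (series (f ^~ w)).
  apply: nondecreasing_is_cvgn.
    by apply: nondecreasing_series => N _ _; exact: f0.
  exists (fine (g w)) => _ [M _ <-].
  rewrite -lee_fin fineK// /series /= -sumEFin.
  by apply: nneseries_lim_ge => N _ _; rewrite lee_fin.
have h := cvg_series_cvg_0 cvs.
apply/norm_cvg0P; rewrite (_ : (fun N => _) = (fun N => Num.sqrt (f N w))).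
  by rewrite -sqrtr0; apply: continuous_cvg h; exact: sqrt_continuous.
by apply/funext => N; rewrite sqrtr_sqr.
Unshelve. all: by end_near. Qed.

Definition count_events k w : R := \sum_(l < k) \1_(Y k l) w.

Lemma deviationE K w : deviation K w =
  \sum_(k < K) count_events k w - \sum_(k < K) \sum_(l < k) q l.
Proof.
rewrite /deviation -(pair_big_dep xpredT (fun k l : 'I_K => (l < k)%N)
  (fun k l => \1_(Y k l) w - q l)) /= -sumrB; apply: eq_bigr => k _.
rewrite sumrB /count_events; congr (_ - _).
  by rewrite (big_ord_widen K (fun l => \1_(Y k l) w))// ltnW.
by rewrite (big_ord_widen K (fun l => q l))// ltnW.
Qed.

Lemma count_events_lln (Q : R) : (\sum_(l < k) q l) @[k --> \oo] --> Q ->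
  {ae P, forall w,
    (\sum_(k < N.+1 ^ 2) count_events k w) / (N.+1 ^ 2)%:R @[N --> \oo] --> Q}.
Proof.
move=> qQ; apply: filterS deviation_ae => w hw.
have hm : ((\sum_(k < N.+1 ^ 2) \sum_(l < k) q l) / (N.+1 ^ 2)%:R) @[N --> \oo] --> Q.
  have h := cesaro qQ.
  (* [arithmetic_mean] at index [m] averages [m + 1] terms, so an average of [m] terms sits at index
     [m.-1]. *)
  have key m : (0 < m)%N -> arithmetic_mean (fun k => \sum_(l < k) q l) m.-1 =
      (\sum_(k < m) \sum_(l < k) q l) / m%:R.
    by case: m => // m _; rewrite /arithmetic_mean /series /= big_mkord mulrC.
  have sub : (N.+1 ^ 2).-1%N @[N --> \oo] --> \oo.
    apply/cvgnyPge => A; near=> N; near: N; exists A => // N /= AN.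
    rewrite /=; nia.
  have := cvg_comp _ _ sub h; apply: cvg_trans; apply: near_eq_cvg; near=> N.
  by rewrite -key// expn_gt0.
rewrite -[Q]addr0 addrC.
rewrite (_ : (fun N => _) = (fun N => deviation (N.+1 ^ 2) w / (N.+1 ^ 2)%:R +
  (\sum_(k < N.+1 ^ 2) \sum_(l < k) q l) / (N.+1 ^ 2)%:R)); first exact: cvgD.
by apply/funext => N; rewrite deviationE -mulrDl subrK.
Unshelve. all: by end_near. Qed.

End weak_dependence.

(** * The integral of [g ^ n] *)

Lemma is_derive_pow (R : realType) (f : R -> R) (df x : R) p :
  is_derive x 1 f df -> is_derive x 1 (fun y => f y ^+ p) (p%:R * f x ^+ p.-1 * df).
Proof.
move=> hf; have := is_deriveX p hf.
by rewrite (_ : f ^+ p = fun y => f y ^+ p)//; apply/funext => y; rewrite fctE.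
Qed.

Section moment_integral.
Context (R : realType) (n : nat) (lam mu : R).
Hypotheses (n0 : (0 < n)%N) (lam0 : 0 < lam) (mu0 : 0 < mu).

Let c (x : R) := expR (- mu * x).
Let g := hypo mu lam.
Lemma is_derive_monomial p q (x : R) :
  is_derive x 1 (fun y => c y ^+ p * g y ^+ q)
    (q%:R * lam * (c x ^+ p.+1 * g x ^+ q.-1) -
     (p%:R * mu + q%:R * lam) * (c x ^+ p * g x ^+ q)).
Proof.
have dc := is_derive_pow p (is_derive_expRM mu x).
have dg := is_derive_pow q (is_derive_hypo mu lam x).
apply: (is_derive_eq (is_deriveM dc dg)).
rewrite -/(c x) -/g /GRing.scale /=.
case: p {dc} => [|p]; case: q {dg} => [|q]; rewrite /= ?expr0 ?exprS; ring.
Qed.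

Let rate m : R := (n - m)%:R * mu + m%:R * lam.

Let rate_gt0 m : 0 < rate m.
Proof.
rewrite /rate; case: m => [|m].
  by rewrite subn0 mul0r addr0 mulr_gt0// ltr0n.
by rewrite ltr_wpDl// ?mulr_gt0// mulr_ge0// ltW.
Qed.

(* [antider m] is the primitive of [- c ^ (n - m) g ^ m] vanishing at infinity;
   the recursion comes from [g' = - lam (g - c)]. *)
Fixpoint antider m (x : R) : R :=
  if m is m'.+1 then
    (c x ^+ (n - m) * g x ^+ m + m%:R * lam * antider m' x) / rate m
  else c x ^+ n / rate 0.

Lemma is_derive_antider m (x : R) : (m <= n)%N ->
  is_derive x 1 (antider m) (- (c x ^+ (n - m) * g x ^+ m)).
Proof.
have div (f : R -> R) df r : is_derive x 1 f df -> is_derive x 1 (fun y => f y / r) (df / r).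
  move=> hf; have := is_deriveZ r^-1 hf; rewrite /GRing.scale /= mulrC.
  by rewrite (_ : _ \*: f = fun y => f y / r)//; apply/funext => y; rewrite mulrC.
elim: m => [_|m ih mn] /=.
  have := div _ _ (rate 0) (is_derive_monomial n 0 x).
  rewrite (_ : (fun y => _) = (fun y => c y ^+ n / rate 0)); last first.
    by apply/funext => y; rewrite expr0 mulr1.
  move/is_derive_eq; apply; rewrite subn0 expr0 mulr1 !mul0r sub0r addr0.
  have n0' : n%:R != 0 :> R by rewrite pnatr_eq0 -lt0n.
  by rewrite /rate subn0 mul0r addr0; field; rewrite n0' gt_eqF.
have dm := ih (ltnW mn).
have e : (n - m)%N = (n - m.+1).+1 by rewrite subnSK.
have := is_deriveD (is_derive_monomial (n - m.+1) m.+1 x) (is_deriveZ (m.+1%:R * lam) dm).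
move/(div _ _ (rate m.+1))/is_derive_eq; apply.
rewrite /GRing.scale /= e; have := rate_gt0 m.+1; rewrite /rate => r0.
by field; rewrite nat1r gt_eqF.
Qed.

Fixpoint antider0 m : R :=
  if m is m'.+1 then (1 + m%:R * lam * antider0 m') / rate m else (rate 0)^-1.

Lemma antiderE0 m : antider m 0 = antider0 m.
Proof.
have c0 : c 0 = 1 by rewrite /c mulr0 expR0.
have g0 : g 0 = 1 by rewrite /g hypo0.
by elim: m => [|m ih] /=; rewrite c0 ?g0 !expr1n ?ih ?mulr1 ?mul1r.
Qed.

Lemma antider0_ge0 m : 0 <= antider0 m.
Proof.
elim: m => [|m ih] /=; first by rewrite invr_ge0 ltW.
by rewrite divr_ge0 ?(ltW (rate_gt0 _))// addr_ge0// !mulr_ge0// ltW.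
Qed.

Lemma prodPS (rho : R) j : prodP n rho j.+1 =
  prodP n rho j * (rho * (n - j.+1 + 1)%:R / (j.+1%:R + (n - j.+1)%:R * rho)).
Proof. by rewrite /prodP big_nat_recr. Qed.

(** The recursion of [antider0] is unfolded [k + 1] times from [n] down. Factor [i] of [prodP] pairs
    the coefficient [(n - i + 1) lam] of one step with the denominator [rate (n - i)] of the next;
    this shift accounts for the prefactor [1 / (n lam)] and for [(n - k) / n] in the remainder. *)
Lemma antider0_unroll k : (k < n)%N ->
  antider0 n = (n%:R * lam)^-1 * (1 + \sum_(1 <= j < k.+1) prodP n (lam / mu) j)
    + prodP n (lam / mu) k * (n - k)%:R / n%:R * antider0 (n - k.+1).
Proof.
have nn : n%:R != 0 :> R by rewrite pnatr_eq0 -lt0n.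
elim: k => [_|k ih kn].
  rewrite big_geq// /prodP big_geq// addr0 subn0 subn1 mul1r divff// mul1r mulr1.
  rewrite -{1}(prednK n0) /= prednK// /rate subnn mul0r add0r.
  by field; rewrite nn gt_eqF.
rewrite ih 1?ltnW// [in RHS]big_nat_recr//= prodPS.
have ek : (n - k)%N = (n - k.+1 + 1)%N by rewrite addn1 subnSK// ltnW.
rewrite -ek.
have -> : (n - k.+1)%N = (n - k.+2).+1 by rewrite subnSK.
rewrite /= /rate.
have -> : (n - (n - k.+2).+1)%N = k.+1 by move: kn; lia.
have : k.+1%:R * mu + (n - k.+2).+1%:R * lam != 0.
  by rewrite gt_eqF// addr_gt0// mulr_gt0.
have lam_n0 : lam != 0 by rewrite gt_eqF.
have mu_n0 : mu != 0 by rewrite gt_eqF.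
move: (\sum_(_ <= _ < _) _) (prodP _ _ _) (antider0 _) nn => s p a.
move: n%:R (n - k)%:R (n - k.+2).+1%:R k.+1%:R => N e b x N0 h.
by field; rewrite ?N0 ?lam_n0 ?mu_n0 ?h.
Qed.

Lemma antider0_age_formula : antider0 n = age_formula n lam mu.
Proof.
have nn : n%:R != 0 :> R by rewrite pnatr_eq0 -lt0n.
have lam_n0 : lam != 0 by rewrite gt_eqF.
have mu_n0 : mu != 0 by rewrite gt_eqF.
have n1 : (n.-1 < n)%N by rewrite prednK.
(* With [k = n - 1] the remainder is [antider0 0 = 1 / (n mu)] with factor [1 / n], which yields the
   last term of the formula. *)
rewrite (antider0_unroll n1) prednK// subnn /= /rate subn0 mul0r addr0.
have -> : (n - n.-1)%N = 1%N by move: n0; lia.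
rewrite /age_formula; move: (\sum_(_ <= _ < _) _) (prodP _ _ _) => s p.
by field; rewrite nn lam_n0 mu_n0.
Qed.

Hypothesis g_ge0 : forall x, 0 <= x -> 0 <= g x.
Hypothesis g_le1 : forall x, 0 <= x -> g x <= 1.
Hypothesis g_homo : forall x y, 0 <= x -> x <= y -> g y <= g x.
Hypothesis g_cvg0 : g x @[x --> +oo] --> 0.

Let c_ge0 x : 0 <= c x. Proof. exact: expR_ge0. Qed.

Let c_le1 x : 0 <= x -> c x <= 1.
Proof. by move=> x0; rewrite /c -expR0 ler_expR mulNr oppr_le0 mulr_ge0// ltW. Qed.

Lemma antider_ge0 m x : 0 <= x -> 0 <= antider m x.
Proof.
move=> x0; have gx := g_ge0 x0; elim: m => [|m ih] /=.
  by rewrite divr_ge0 ?exprn_ge0// ltW.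
by rewrite divr_ge0 ?(ltW (rate_gt0 _))// addr_ge0// !mulr_ge0// ?exprn_ge0// ltW.
Qed.

(** Both [c] and [g] lie in [[0, 1]], so every nonconstant monomial in them is at most [c + g]. It
    follows that the primitive vanishes at infinity. *)
Lemma antider_le m x : 0 <= x -> antider m x <= antider0 m * (c x + g x).
Proof.
move=> x0; have gx0 := g_ge0 x0; have gx1 := g_le1 x0.
have cx0 := c_ge0 x; have cx1 := c_le1 x0.
have cg0 : 0 <= c x + g x by exact: addr_ge0.
have mon k l : (0 < k + l)%N -> c x ^+ k * g x ^+ l <= c x + g x.
  case: k => [|k] h.
    rewrite expr0 mul1r (le_trans (ler_wiXn2l _ _ h))// expr1; lra.
  rewrite (@le_trans _ _ (c x))//; last lra.
  rewrite exprS -mulrA ler_piMr// mulr_ile1 ?exprn_ge0// ?exprn_ile1//.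
elim: m => [|m ih] /=.
  rewrite mulrC ler_pM2l ?invr_gt0//.
  by have := mon n 0; rewrite addn0 expr0 mulr1; apply.
rewrite [leRHS]mulrAC ler_pM2r ?invr_gt0// mulrDl mul1r lerD//.
  by apply: mon; rewrite addnS.
by rewrite -[leRHS]mulrA; apply: ler_wpM2l => //; rewrite mulr_ge0// ltW.
Qed.

Let F := antider n.

(** The integral of [g ^ n] is handled only through increments of its primitive; with [g] monotone,
    the mean value theorem compares them with Riemann sums. *)
Lemma antider_mvt (a b : R) : 0 <= a -> a < b ->
  (b - a) * g b ^+ n <= F a - F b <= (b - a) * g a ^+ n.
Proof.
move=> a0 ab.
have dF (x : R) : is_derive x 1 F (- (g x ^+ n)).
  by have := is_derive_antider x (leqnn n); rewrite subnn expr0 mul1r.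
have cF : {within `[a, b], continuous F}.
  apply: derivable_within_continuous => x _.
  by have [] := dF x.
have [x] := @MVT R F (fun x => - (g x ^+ n)) a b ab (fun x _ => dF x) cF.
rewrite in_itv/= => /andP[ax xb] e.
have -> : F a - F b = (b - a) * g x ^+ n by rewrite -opprB e; ring.
have x0 : 0 <= x by lra.
have ba : 0 <= b - a by lra.
rewrite !ler_wpM2l//; apply: lerXn2r; rewrite ?nnegrE; do ?apply: g_ge0; do ?apply: g_homo; lra.
Qed.

Let s (dt : R) k := \sum_(l < k) g (l%:R * dt) ^+ n.

(** Subtracting 1 removes the term at 0, where [g] is 1, and so turns the left-endpoint sum with
    [k + 1] terms into the right-endpoint sum. *)
Lemma riemann_sum_bounds (dt : R) k : 0 < dt ->
  dt * (s dt k.+1 - 1) <= F 0 - F (k%:R * dt) <= dt * s dt k.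
Proof.
move=> dt0; have g0 : g 0 = 1 by rewrite /g hypo0.
elim: k => [|k /andP[ih1 ih2]].
  by rewrite /s big_ord1 !big_ord0 !mul0r g0 expr1n !subrr mulr0 lexx.
have kd : 0 <= k%:R * dt by rewrite mulr_ge0// ltW.
have := antider_mvt kd (_ : k%:R * dt < k.+1%:R * dt).
rewrite -natr1 mulrDl mul1r => /(_ (ltr_pwDr dt0 (lexx _)))/andP[h1 h2].
have e1 : s dt k.+1 = s dt k + g (k%:R * dt) ^+ n by rewrite /s big_ord_recr.
have e2 : s dt k.+2 = s dt k.+1 + g (k%:R * dt + dt) ^+ n.
  by rewrite /s big_ord_recr/= -natr1 mulrDl mul1r.
move: h1 h2 ih1 ih2; rewrite e2 e1 (addrC _ dt) addrK !mulrDr => h1 h2 ih1 ih2.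
by apply/andP; split; lra.
Qed.

Lemma riemann_sum_cvg (dt : R) : 0 < dt -> exists2 Q,
  s dt k @[k --> \oo] --> Q & age_formula n lam mu <= dt * Q <= age_formula n lam mu + dt.
Proof.
move=> dt0; set A := age_formula _ _ _.
have F0 : F 0 = A by rewrite /F antiderE0 antider0_age_formula.
have kd k : 0 <= k%:R * dt :> R by rewrite mulr_ge0// ltW.
have nd : nondecreasing_seq (s dt).
  apply/nondecreasing_seqP => k; rewrite /s big_ord_recr/= lerDl exprn_ge0//.
  exact: g_ge0.
have ub k : dt * s dt k <= A + dt.
  case: k => [|k]; first by rewrite /s big_ord0 mulr0 addr_ge0 ?(ltW dt0)// -F0 antider_ge0.
  have /andP[h _] := riemann_sum_bounds k dt0.
  by have := antider_ge0 n (kd k); move: h; rewrite -/F F0 mulrBr mulr1; lra.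
have cs : cvgn (s dt).
  apply: nondecreasing_is_cvgn => //; exists ((A + dt) / dt) => _ [k _ <-].
  by rewrite ler_pdivlMr// mulrC.
exists (limn (s dt)) => //.
have cds : dt * s dt k @[k --> \oo] --> dt * limn (s dt).
  by apply: cvgM => //; exact: cvg_cst.
apply/andP; split; last first.
  rewrite -(cvg_lim _ cds)//; apply: limr_le; first by apply/cvg_ex; exists (dt * limn (s dt)).
  by near=> k.
have kdy : (k%:R * dt : R) @[k --> \oo] --> +oo.
  have h := cvg_comp _ _ (@cvgr_idn R) (gt0_cvgMly dt0 (@cvg_id _ _)).
  exact: h.
have Fk : F (k%:R * dt) @[k --> \oo] --> 0.
  apply: (@squeeze_cvgr _ _ _ _ (fun=> 0) (fun k => antider0 n * (c (k%:R * dt) + g (k%:R * dt)))).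
  - by near=> k; rewrite antider_ge0//= antider_le.
  - exact: cvg_cst.
  rewrite -[X in _ --> X](mulr0 (antider0 n)) -[X in _ * X](addr0 (0 : R)).
  apply: cvgM; first exact: cvg_cst.
  have hg := cvg_comp _ _ kdy g_cvg0.
  apply: cvgD; last exact: hg.
  have h := cvg_comp _ _ (cvg_comp _ _ kdy (gt0_cvgMry mu0 (@cvg_id _ _))) (@cvgr_expR R).
  rewrite (_ : (fun k => c (k%:R * dt)) = (fun k => expR (- (mu * (k%:R * dt))))); first exact: h.
  by apply/funext => k; rewrite /c mulNr.
have AF : A - F (k%:R * dt) @[k --> \oo] --> A - 0 by apply: cvgB => //; exact: cvg_cst.
rewrite subr0 in AF; rewrite -(cvg_lim _ AF)// -(cvg_lim _ cds)//.
apply: ler_lim; [by apply/cvg_ex; exists A|by apply/cvg_ex; exists (dt * limn (s dt))|].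
by near=> k; have /andP[_] := riemann_sum_bounds k dt0; rewrite F0.
Unshelve. all: by end_near. Qed.

End moment_integral.

(** * Sample paths of the age *)

Section interpolation.
Context (R : realType).

Lemma square_cvg_mean (I : R -> R) (A : R) : 0 <= A ->
  (forall x y, 0 <= x -> x <= y -> I x <= I y) ->
  (forall e, 0 < e -> exists2 dt, 0 < dt & \forall N \near \oo,
    `|I ((N.+1 ^ 2)%:R * dt) - A * ((N.+1 ^ 2)%:R * dt)| <= e * ((N.+1 ^ 2)%:R * dt)) ->
  t^-1 * I t @[t --> +oo] --> A.
Proof.
move=> A0 mI h; apply/cvgrPdist_le => e e0.
(* Error budget for [K N <= t < K (N + 1)]: the hypothesis costs [e / 5 * K (N + 1)], at most
   [4 e / 5 * K N], and the gap costs [A * 3 (N + 1) dt], at most [e / 5 * K N] once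
   [N + 1 >= 15 A / e]. *)
have e50 : 0 < e / 5 by rewrite divr_gt0.
have [dt dt0 [N0 _ hN0]] := h _ e50.
pose K N : R := (N.+1 ^ 2)%:R * dt.
have KE N : K N = N.+1%:R ^+ 2 * dt by rewrite /K natrX.
have K0 N : 0 < K N by rewrite /K mulr_gt0// ltr0n expn_gt0.
have Kmono N N' : (N <= N')%N -> K N <= K N'.
  by move=> NN'; rewrite /K ler_pM2r// ler_nat leq_exp2r.
have Kge N : N.+1%:R * dt <= K N.
  by rewrite /K ler_pM2r// ler_nat; nia.
pose M := maxn N0 (Num.truncn (15 * A / e)).
near=> t.
have tK : K M.+1 <= t by near: t; apply: nbhs_pinfty_ge; rewrite num_real.
have ex : exists N, t < K N.
  exists (Num.truncn (t / dt)); apply: lt_le_trans (Kge _).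
  by rewrite -ltr_pdivrMr//; exact: truncnS_gt.
have t0 : 0 < t by exact: lt_le_trans (K0 _) tK.
case: (ex_minnP ex) => -[|N] tN minN.
  have : K 0%N <= K M.+1 by exact: Kmono.
  by move=> /le_trans/(_ tK); rewrite leNgt tN.
have KNt : K N <= t by rewrite leNgt; apply/negP => /minN; rewrite ltnn.
have MN : (M < N.+1)%N.
  rewrite ltnNge; apply/negP => NM.
  have : K N.+1 <= K M.+1 by apply: Kmono; exact: leqW.
  by move=> /le_trans/(_ tK); rewrite leNgt tN.
have N0N : (N0 <= N)%N by rewrite -ltnS (leq_ltn_trans _ MN)// leq_maxl.
have h1 := hN0 N N0N; have h2 := hN0 N.+1 (leqW N0N).
rewrite -/(K _) in h1; rewrite -/(K _) in h2.
have i1 := mI _ _ (ltW (K0 N)) KNt; have i2 := mI _ _ (ltW t0) (ltW tN).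
have dK : K N.+1 <= K N + 3 * (N.+1%:R * dt).
  rewrite !KE -[N.+2%:R]natr1; set x : R := N.+1%:R.
  have x1 : 1 <= x by rewrite ler1n.
  rewrite mulrA -mulrDl ler_pM2r//; nra.
have A3 : A * (3 * (N.+1%:R * dt)) <= e / 5 * K N.
  have hA : 15 * A / e <= N.+1%:R.
    apply: (le_trans (ltW (truncnS_gt _))); rewrite ler_nat; apply: leq_trans MN.
    by rewrite ltnS leq_maxr.
  move: hA; rewrite ler_pdivrMr// KE; set x : R := N.+1%:R => hA.
  have x0 : 0 <= x by [].
  have : 15 * A * x <= x * e * x by rewrite ler_wpM2r.
  rewrite -(ler_pM2r dt0); lra.
have K4 : K N.+1 <= 4 * K N.
  by have := Kge N; lra.
have AK1 := ler_wpM2l A0 KNt; have AK2 := ler_wpM2l A0 (ltW tN).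
have AK3 := ler_wpM2l A0 dK.
have eK : e / 5 * K N.+1 <= e / 5 * (4 * K N) by rewrite ler_wpM2l// ltW.
have eKt : e * K N <= e * t by rewrite ler_wpM2l// ltW.
have {h1 h2} [h1 h2] : A * K N - I (K N) <= e / 5 * K N /\
    I (K N.+1) - A * K N.+1 <= e / 5 * K N.+1.
  by move: h1 h2; rewrite !ler_norml => /andP[? ?] /andP[? ?]; split; lra.
have -> : A - t^-1 * I t = (A * t - I t) / t by field; rewrite gt_eqF.
rewrite normrM normfV (gtr0_norm t0) ler_pdivrMr// ler_norml mulrDr in AK3 *.
by apply/andP; split; lra.
Unshelve. all: by end_near. Qed.

End interpolation.

(** * Age along a fixed path, compared with the count of stale events *)

Section sample_path.
Context (R : realType) (n : nat) d (T : measurableType d) (X S : 'I_n -> nat -> T -> R) (w : T).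
Hypothesis S0 : forall j k, 0 <= S j k w.

Notation mu := (@lebesgue_measure R).
Notation u := (latest_gen X S w).
Notation agew := (age X S w).

Let gens (t : R) : set R := [set 0] `|` [set a | exists (j : 'I_n) (k : nat),
  [/\ delivered X S j k w, arrival X j k w + S j k w <= t & a = arrival X j k w]].

Let gens_ub t : 0 <= t -> ubound (gens t) t.
Proof.
move=> t0 a [->//|[j [k [_ at' ->]]]].
by apply: le_trans at'; rewrite lerDl.
Qed.

Let gens0 t : gens t 0. Proof. by left. Qed.

Lemma latest_gen_ge0 t : 0 <= t -> 0 <= u t.
Proof. by move=> t0; apply: ub_le_sup; [exists t; exact: gens_ub|exact: gens0]. Qed.

Lemma latest_gen_le t : 0 <= t -> u t <= t.
Proof. by move=> t0; apply: ge_sup; [exists 0; exact: gens0|exact: gens_ub]. Qed.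

Lemma latest_gen_homo s t : 0 <= s -> s <= t -> u s <= u t.
Proof.
move=> s0 st; apply: ge_sup; first by exists 0; exact: gens0.
move=> a ga; apply: ub_le_sup; first by exists t; apply: gens_ub; exact: le_trans st.
case: ga => [->|[j [k [dk sk ->]]]]; first by left.
by right; exists j, k; split => //; exact: le_trans st.
Qed.

Lemma age_ge_stale s t : 0 <= s -> stale X S s t w -> t - s <= agew t.
Proof.
move=> s0 st; rewrite /age lerD2l lerN2; apply: ge_sup; first by exists 0; exact: gens0.
move=> a [->//|[j [k [dk tk ->]]]]; rewrite leNgt; apply/negP => sa.
by apply: (st j k); split => //; exact: ltW.
Qed.

Lemma age_le_not_stale s t : 0 <= t -> ~ stale X S s t w -> agew t <= t - s.
Proof.
rewrite /stale /server_stale /= => t0.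
rewrite -existsNE => -[j]; rewrite -existsNE => -[k] /contrapT[sa dk tk].
rewrite /age lerD2l lerN2; apply: (le_trans sa); apply: ub_le_sup.
  by exists t; exact: gens_ub.
by right; exists j, k.
Qed.

Lemma age_ge0 t : 0 <= t -> 0 <= agew t.
Proof. by move=> t0; rewrite subr_ge0 latest_gen_le. Qed.

Lemma age_le t : 0 <= t -> agew t <= t.
Proof. by move=> t0; rewrite gerBl latest_gen_ge0. Qed.

Lemma stale_le s s' t : s <= s' -> stale X S s t w -> stale X S s' t w.
Proof. by move=> ss' h j k [sa dk tk]; apply: (h j k); split => //; exact: le_trans sa. Qed.

Lemma age_integrable (tau : R) : 0 <= tau -> mu.-integrable `[0, tau] (EFin \o agew).
Proof.
move=> tau0; apply: measurable_bounded_integrable => //.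
- by rewrite /= lebesgue_measure_itv/= lte_fin; case: ifP => _; rewrite ?ltry// -EFinD ltry.
- have mu' : measurable_fun setT (fun t : R => u (Num.max 0 t)).
    apply: nondecreasing_measurable => // s t st; apply: latest_gen_homo.
      by rewrite le_max lexx.
    by rewrite ge_max !le_max lexx st orbT.
  apply: (eq_measurable_fun (fun t : R => t - u (Num.max 0 t))).
    by move=> t; rewrite inE/= in_itv/= => /andP[t0 _]; rewrite /age (max_idPr t0).
  apply: measurable_funTS; exact: measurable_funB.
- exists tau; split; first exact: num_real.
  move=> x tx t; rewrite /= in_itv/= => /andP[t0 tt].
  by rewrite ger0_norm ?age_ge0// (le_trans (age_le t0))// (le_trans tt)// ltW.
Qed.

Definition age_integral (tau : R) := Rintegral mu `[0, tau] agew.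

Lemma age_integral_increment (a b m M : R) : 0 <= a -> a <= b ->
  (forall t, a <= t <= b -> m <= agew t <= M) ->
  m * (b - a) <= age_integral b - age_integral a <= M * (b - a).
Proof.
move=> a0 ab h; have b0 := le_trans a0 ab.
rewrite /age_integral Rintegral_itvB ?bnd_simp//; last exact: age_integrable.
have iab : mu.-integrable `]a, b] (EFin \o agew).
  apply: integrableS (age_integrable b0) => //.
  by move=> t /=; rewrite !in_itv/= => /andP[/ltW/(le_trans a0) -> ->].
have mab : (mu `]a, b]%classic < +oo)%E.
  by rewrite /= lebesgue_measure_itv/= lte_fin; case: ifP => _; rewrite ?ltry// -EFinD ltry.
have int_cst x : Rintegral mu `]a, b] (cst x) = x * (b - a).
  rewrite Rintegral_cst//= lebesgue_measure_itv/= lte_fin.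
  move: ab; rewrite le_eqVlt => /predU1P[->|->]; first by rewrite ltxx subrr.
  by rewrite -EFinD.
have icst x : mu.-integrable `]a, b] (EFin \o cst x).
  apply: measurable_bounded_integrable => //.
  by exists `|x|; split => [|y xy t _]; [exact: num_real|exact: ltW].
have hmM t : `]a, b]%classic t -> m <= agew t <= M.
  by rewrite /= in_itv/= => /andP[at' tb]; apply: h; rewrite (ltW at').
rewrite -!int_cst; apply/andP; split.
  by apply: le_Rintegral; [|exact: icst|exact: iab|move=> t /hmM /andP[]].
by apply: le_Rintegral; [|exact: iab|exact: icst|move=> t /hmM /andP[]].
Qed.

Lemma age_integral_homo (a b : R) : 0 <= a -> a <= b -> age_integral a <= age_integral b.
Proof.
move=> a0 ab.
have h t : a <= t <= b -> 0 <= agew t <= b.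
  move=> /andP[at' tb]; have t0 := le_trans a0 at'.
  by rewrite age_ge0//= (le_trans (age_le t0)).
by have /andP[+ _] := age_integral_increment a0 ab h; rewrite mul0r subr_ge0.
Qed.

Context (dt : R) (Y : nat -> nat -> set T).
Hypothesis dt0 : 0 < dt.
Hypothesis Y_stale : forall k l, (l < k)%N -> Y k l w <->
  stale X S ((k - l)%:R * dt) (k%:R * dt) w.

Lemma downward_closed_prefix (p : nat -> Prop) k :
  (forall l l', (l <= l')%N -> (l' < k)%N -> p l' -> p l) ->
  exists2 m, (m <= k)%N & forall l, (l < k)%N -> p l <-> (l < m)%N.
Proof.
elim: k => [|k ih] h; first by exists 0%N.
have [pk|npk] := pselect (p k).
  exists k.+1 => // l lk; split => // _; exact: h pk.
have [l l' ll' lk|m mk hm] := ih; first by apply: h => //; exact: leqW.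
exists m => [|l]; first exact: leqW.
rewrite ltnS leq_eqVlt => /predU1P[->|]; last exact: hm.
by split => [//|km]; move: mk; rewrite leqNgt km.
Qed.

(** The stale lags below [k] form an initial segment [l < m], so the count is [m]. Staleness at lag
    [m - 1] bounds the age from below, its failure at lag [m] from above; for [m = k] the upper
    bound is the elapsed time. *)
Lemma age_count k :
  (count_events R Y k w - 1) * dt <= agew (k%:R * dt) <= count_events R Y k w * dt.
Proof.
have kd : 0 <= k%:R * dt by rewrite mulr_ge0// ltW.
have [|m mk hm] := @downward_closed_prefix (fun l => Y k l w) k.
  move=> l l' ll' lk' /(Y_stale lk') h; apply/(Y_stale (leq_ltn_trans ll' lk')).
  by apply: stale_le h; rewrite ler_pM2r// ler_nat leq_sub2l.
have -> : count_events R Y k w = m%:R :> R.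
  rewrite /count_events (eq_bigr (fun l : 'I_k => if (l < m)%N then 1 else 0)); last first.
    move=> l _; rewrite indicE; case: ifPn => lm; first by rewrite mem_set//; apply/hm.
    by rewrite memNset// => /(hm _ (ltn_ord l)); exact/negP.
  by rewrite -big_mkcond/= -(big_ord_widen k (fun=> 1))// sumr_const card_ord.
have sub l : (l <= k)%N -> k%:R * dt - (k - l)%:R * dt = l%:R * dt.
  by move=> lk; rewrite -mulrBl natrB// opprB addrC subrK.
apply/andP; split.
  case: m mk hm => [|m] mk hm.
    by rewrite sub0r mulN1r (le_trans _ (age_ge0 kd))// oppr_le0 ltW.
  have /(Y_stale mk) st := (hm m mk).2 (ltnSn m).
  rewrite -natr1 addrK -(sub m (ltnW mk)); apply: age_ge_stale st.
  by rewrite mulr_ge0// ltW.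
move: mk; rewrite leq_eqVlt => /predU1P[->|mk]; first exact: age_le.
rewrite -(sub m (ltnW mk)); apply: age_le_not_stale => // /(Y_stale mk)/(hm m mk).
by rewrite ltnn.
Qed.

Lemma age_integral_count K :
  `|age_integral (K%:R * dt) - dt ^+ 2 * \sum_(k < K) count_events R Y k w| <=
  2 * dt * (K%:R * dt).
Proof.
have I0 : age_integral (0 * dt) = 0.
  by rewrite mul0r /age_integral set_itv1 Rintegral_set1.
have c0 k : 0 <= count_events R Y k w :> R.
  by apply: sumr_ge0 => l _; rewrite indicE.
have c00 : count_events R Y 0 w = 0 :> R by rewrite /count_events big_ord0.
(* Since [u] is monotone, the age on a mesh interval is bounded above from the left endpoint and
   below from the right one. The lower sums are thus shifted by one index, whence the boundary term
   [count_events R Y K w], which is nonnegative. *)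
suff : dt ^+ 2 * (\sum_(k < K) count_events R Y k w + count_events R Y K w - 2 * K%:R) <=
    age_integral (K%:R * dt) <= dt ^+ 2 * (\sum_(k < K) count_events R Y k w + K%:R).
  have := mulr_ge0 (sqr_ge0 dt) (c0 K).
  have : 0 <= dt ^+ 2 * K%:R by rewrite mulr_ge0// sqr_ge0.
  rewrite [2 * dt * _](_ : _ = 2 * (dt ^+ 2 * K%:R)); last by ring.
  by rewrite !(mulrDr (dt ^+ 2)) ler_norml => ? ? /andP[? ?]; apply/andP; split; lra.
elim: K => [|K /andP[ih1 ih2]].
  by rewrite !big_ord0 I0 c00 mulr0 !addr0 subr0 mulr0 lexx.
have kd : 0 <= K%:R * dt by rewrite mulr_ge0// ltW.
have e : K.+1%:R * dt = K%:R * dt + dt by rewrite -natr1 mulrDl mul1r.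
have kd1 : K%:R * dt <= K%:R * dt + dt by rewrite lerDl ltW.
have := @age_integral_increment _ _ ((count_events R Y K.+1 w - 2) * dt)
  ((count_events R Y K w + 1) * dt) kd kd1.
rewrite [_ + dt - _]addrAC subrr add0r => h.
have /h/andP[h1 h2] : forall t, K%:R * dt <= t <= K%:R * dt + dt ->
    (count_events R Y K.+1 w - 2) * dt <= agew t <= (count_events R Y K w + 1) * dt.
  move=> t /andP[t1 t2].
  have /andP[_ a1] := age_count K; have /andP[a2 _] := age_count K.+1.
  have u1 := latest_gen_homo kd t1; have u2 := latest_gen_homo (le_trans kd t1) t2.
  move: a1 a2; rewrite e /age !mulrDl; lra.
rewrite e !big_ord_recr/= -[K.+1%:R]natr1.
by apply/andP; split; lra.
Qed.

End sample_path.

Theorem theorem1 (R : realType) (d : measure_display) (T : measurableType d)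
  (P : probability T R) (n : nat) (lam mu : R)
  (X S : 'I_n -> nat -> {RV P >-> R}) :
  (0 < n)%N -> 0 < lam -> 0 < mu ->
  mutually_independent P (all_rvs (fun j k => (X j k : T -> R))
                                  (fun j k => (S j k : T -> R))) ->
  (forall j k, exp_distributed lam (X j k)) ->
  (forall j k, exp_distributed mu (S j k)) ->
  {ae P, forall w,
    avg_age_upto (fun j k => (X j k : T -> R)) (fun j k => (S j k : T -> R)) w tau
      @[tau --> +oo] --> age_formula n lam mu}.
Proof.
move=> n0 lam0 mu0 indF X_exp S_exp.
pose X' j k : T -> R := X j k; pose S' j k : T -> R := S j k.
pose g := hypo mu lam; pose j0 := Ordinal n0.
have g_ge0 y : 0 <= y -> 0 <= g y := hypo_network_ge0 lam0 mu0 indF X_exp S_exp j0 (y := y).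
have g_le1 y : 0 <= y -> g y <= 1 := hypo_network_le1 lam0 mu0 indF X_exp S_exp j0 (y := y).
have g_homo y z : 0 <= y -> y <= z -> g z <= g y.
  exact: (hypo_network_homo lam0 mu0 indF X_exp S_exp j0).
pose nu := Num.min mu lam.
have nu0 : 0 < nu by rewrite lt_min mu0.
have g_decay y : 0 <= y -> g y <= 2 * expR (- nu * (y / 2)).
  move=> y0; apply: (le_trans (hypo_network_decay lam0 mu0 indF X_exp S_exp j0 y0)).
  have y20 : 0 <= y / 2 by lra.
  rewrite mulr_natl mulr2n lerD// ler_expR !mulNr lerN2 ler_wpM2r// /nu ge_min lexx ?orbT//.
have g_cvg0 : g x @[x --> +oo] --> 0.
  apply: (@squeeze_cvgr _ _ _ _ (fun=> 0) (fun x => 2 * expR (- nu * (x / 2)))).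
  - near=> x; have x0 : 0 <= x by near: x; apply: nbhs_pinfty_ge; rewrite num_real.
    by rewrite g_ge0//= g_decay.
  - exact: cvg_cst.
  rewrite -[X in _ --> X](mulr0 (2 : R)); apply: cvgM; first exact: cvg_cst.
  have nu20 : 0 < nu / 2 by rewrite divr_gt0.
  have h := cvg_comp _ _ (gt0_cvgMry nu20 (@cvg_id _ _)) (@cvgr_expR R).
  rewrite (_ : (fun x => expR (- nu * (x / 2))) = (fun x => expR (- (nu / 2 * x)))); first exact: h.
  by apply/funext => x; congr expR; ring.
pose A := age_formula n lam mu.
(* Countably many meshes, so that one null set serves for all of them. *)
pose dt m : R := m.+1%:R^-1.
have dt0 m : 0 < dt m by rewrite invr_gt0.
pose Y m k l := stale X' S' ((k - l)%:R * dt m) (k%:R * dt m).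
pose q m l := g (l%:R * dt m) ^+ n.
have lln m : exists2 Q, A <= dt m * Q <= A + dt m & {ae P, forall w,
    (\sum_(k < N.+1 ^ 2) count_events R (Y m) k w) / (N.+1 ^ 2)%:R @[N --> \oo] --> Q}.
  have [Q qQ AQ] := riemann_sum_cvg n0 lam0 mu0 g_ge0 g_le1 g_homo g_cvg0 (dt0 m).
  exists Q => //.
  (* The decay [exp (- nu l dt / 2)] has to be written as [tau ^ (4 l)], hence 8; the constant 2
     comes from [g_decay]. *)
  pose tau := expR (- nu * (dt m / 8)).
  have ldt l : 0 <= l%:R * dt m by rewrite mulr_ge0// ltW.
  have pos k l : (l < k)%N -> 0 < (k - l)%:R * dt m.
    by move=> lk; rewrite mulr_gt0// ltr0n subn_gt0.
  have le_kl k l : (k - l)%:R * dt m <= k%:R * dt m.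
    by rewrite ler_pM2r// ler_nat leq_subr.
  have pY k l : (l < k)%N -> pr P (Y m k l) = q m l.
    move=> lk; rewrite (pr_stale lam0 mu0 indF X_exp S_exp)//; last exact: pos.
    by rewrite -mulrBl natrB 1?ltnW// opprB addrC subrK.
  apply: (@count_events_lln _ _ _ _ _ (q m) 2 tau) => //.
  - exact: expR_gt0.
  - by rewrite -expR0 ltr_expR mulNr oppr_lt0 mulr_gt0// divr_gt0.
  - by move=> k l; exact: measurable_stale.
  - move=> k l k' l' lk lk' h; rewrite -(pY k)// -(pY k')//.
    apply: (pr_stale2 lam0 mu0 indF X_exp S_exp) => //; first exact: pos.
    by rewrite ltr_pM2r// ltr_nat; lia.
  - move=> l; rewrite /q.
    apply: (@le_trans _ _ (g (l%:R * dt m))).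
      by rewrite ler_iXnr ?g_ge0 ?g_le1.
    rewrite (le_trans (g_decay _ (ldt l)))// ler_wpM2l// /tau -expRM_natl ler_expR.
    by rewrite natrM le_eqVlt; apply/orP; left; apply/eqP; field.
  - by move=> l; rewrite exprn_ge0// g_ge0.
have /choice[Q hQ] : forall m, exists Q, A <= dt m * Q <= A + dt m /\ {ae P, forall w,
    (\sum_(k < N.+1 ^ 2) count_events R (Y m) k w) / (N.+1 ^ 2)%:R @[N --> \oo] --> Q}.
  by move=> m; have [Q] := lln m; exists Q.
have nonneg : {ae P, forall w, nonneg_times X S w}.
  have mN := measurable_nonneg_times X S.
  exists (~` nonneg_times X S); split => //; first exact: measurableC.
  by rewrite probability_setC// (probability_nonneg_times lam0 mu0 X_exp S_exp) subee.
have := ae_foralln (fun m => (hQ m).2); apply: filterS2 nonneg => w Nw lim.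
have S0 j k : 0 <= S j k w by have [] := Nw j k.
have A0 : 0 <= A by rewrite /A -antider0_age_formula// antider0_ge0.
apply: (@square_cvg_mean _ (age_integral X' S' w)) => //.
  by move=> a b; exact: age_integral_homo.
(* The total relative error is [4 dt]: [2 dt] from counting instead of integrating, [dt] from the
   law of large numbers and [dt] from the Riemann sum. *)
move=> e e0; pose m := Num.truncn (4 / e); exists (dt m) => //.
have dte : 4 * dt m <= e.
  rewrite /dt ler_pdivrMr// mulrC -ler_pdivrMr//.
  exact: ltW (truncnS_gt _).
(* Precision 1 is enough, because the average count is weighted by [dt ^ 2], that is by [dt]
   relative to the elapsed time. *)
have /cvgrPdist_le/(_ _ ltr01) := lim m; apply: filterS => N /= hN.
have K0 : 0 < (N.+1 ^ 2)%:R :> R by rewrite ltr0n expn_gt0.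
have Ys k l : (l < k)%N -> Y m k l w <-> stale X' S' ((k - l)%:R * dt m) (k%:R * dt m) w.
  by [].
have := @age_integral_count _ _ _ _ _ _ _ S0 _ _ (dt0 m) Ys (N.+1 ^ 2)%N.
set I := age_integral _ _ _ _; set s := \sum_(_ < _) _.
set K : R := (N.+1 ^ 2)%:R in K0 hN *; clearbody K => h.
have Kn0 : K != 0 by rewrite gt_eqF.
have e1 : `|dt m ^+ 2 * s - dt m * Q m * (K * dt m)| <= dt m * (K * dt m).
  have -> : dt m ^+ 2 * s - dt m * Q m * (K * dt m) = - (dt m * (K * dt m)) * (Q m - s / K).
    by field.
  have p0 : 0 <= dt m * (K * dt m) by rewrite !mulr_ge0// ltW.
  by rewrite normrM normrN (ger0_norm p0) ler_piMr.
have e2 : `|dt m * Q m * (K * dt m) - A * (K * dt m)| <= dt m * (K * dt m).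
  rewrite -mulrBl normrM (ger0_norm (_ : 0 <= K * dt m)); last by rewrite mulr_ge0// ltW.
  rewrite ler_wpM2r//; first by rewrite mulr_ge0// ltW.
  by have [/andP[? ?] _] := hQ m; rewrite ler_norml; apply/andP; split; have := dt0 m; lra.
have e3 : 4 * dt m * (K * dt m) <= e * (K * dt m) by rewrite ler_wpM2r// mulr_ge0// ltW.
rewrite -/A (le_trans _ e3)// (_ : I - A * (K * dt m) = (I - dt m ^+ 2 * s) +
  ((dt m ^+ 2 * s - dt m * Q m * (K * dt m)) + (dt m * Q m * (K * dt m) - A * (K * dt m)))); last by ring.
apply: (le_trans (ler_normD _ _)); have := ler_normD (dt m ^+ 2 * s - dt m * Q m * (K * dt m))
  (dt m * Q m * (K * dt m) - A * (K * dt m)).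
by lra.
Unshelve. all: by end_near. Qed.
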